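(* Let $\mathcal{G}$ be a finite connected groupoid, $x\in\mathcal{G}_0$, $\tau(x)=\{\tau_y\}_{y\in\mathcal{G}_0}$ a transversal for $x$, $A$ a ring, and $\gamma=(I,\gamma_{\tau(x)},\gamma_{(x)})$ an object of $\mathsf{D}_{\mathcal{G},\tau(x)}(A)$ such that $I_{\tau_y^{-1}}=I_x$ and $I_{\tau_y}=I_y$ for all $y\in\mathcal{G}_0$, $I_x$ is unital, $\gamma_{(x)}$ is a unital partial action, and $A=\bigoplus_{y\in\mathcal{G}_0}I_y$. Let $\theta=\mathtt{Ext}(\gamma)=(B_g,\theta_g)_{g\in\mathcal{G}}$ and $\theta_{(x)}=(B_h,\theta_h)_{h\in\mathcal{G}(x)}$. The following statements are equivalent: (i) $A$ is a $\theta$-partial Galois extension of $A^\theta$ and $t_\theta:A\to A^\theta$ is onto; (ii) the Morita context $(A^\theta,\,A\star_\theta\mathcal{G},\,A,\,A,\,\Gamma,\,\Gamma')$ is strict; (iii) the Morita context $(B_x^{\theta_{(x)}},\,B_x\star_{\theta_{(x)}}\mathcal{G}(x),\,B_x,\,B_x,\,\Gamma_x,\,\Gamma'_x)$ is strict; (iv) $B_x$ is a $\theta_{(x)}$-partial Galois extension of $B_x^{\theta_{(x)}}$ and $t_{\theta_{(x)}}:B_x\to B_x^{\theta_{(x)}}$ is onto.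
   Context: Rings are associative and not necessarily unital; ideals are two-sided. A groupoid $\mathcal{G}$ is a small category in which every morphism is an isomorphism; $g\in\mathcal{G}$ means $g$ is a morphism; $\mathcal{G}_0$ is the set of objects, each object being identified with its identity morphism; $s(g),t(g)$ are source and target; composition is written right to left, so $gh$ is defined iff $s(g)=t(h)$. $\mathcal{G}(x,y)=\{g\in\mathcal{G}: s(g)=x,\ t(g)=y\}$ and $\mathcal{G}(x)=\mathcal{G}(x,x)$. $\mathcal{G}$ is connected if $\mathcal{G}(x,y)\neq\emptyset$ for all $x,y\in\mathcal{G}_0$. A partial action of $\mathcal{G}$ on a ring $A$ is a family $\alpha=(A_g,\alpha_g)_{g\in\mathcal{G}}$ such that: (P1) for each $g$, $A_{t(g)}$ is an ideal of $A$, $A_g$ is an ideal of $A_{t(g)}$ and $\alpha_g:A_{g^{-1}}\to A_g$ is a ring isomorphism; (P2) $\alpha_x=\mathrm{id}_{A_x}$ for $x\in\mathcal{G}_0$; (P3) $\alpha_h^{-1}(A_{g^{-1}}\cap A_h)\subseteq A_{(gh)^{-1}}$ whenever $s(g)=t(h)$; (P4) $\alpha_g(\alpha_h(a))=\alpha_{gh}(a)$ for all $a\in\alpha_h^{-1}(A_{g^{-1}}\cap A_h)$ whenever $s(g)=t(h)$. It is unital if every $A_g$ is a unital ring. A partial action of a group $H$ on a ring $I$ is a partial action of $H$ viewed as a one-object groupoid, the ideal attached to the identity of $H$ being $I$ itself. A transversal for $x\in\mathcal{G}_0$ is a family $\tau(x)=\{\tau_y\}_{y\in\mathcal{G}_0}$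 with $\tau_y\in\mathcal{G}(x,y)$ and $\tau_x=x$. For $g\in\mathcal{G}$ put $g_x:=\tau_{t(g)}^{-1}g\tau_{s(g)}\in\mathcal{G}(x)$. Composition of partial bijections $f:X\to Y$, $f':X'\to Y'$ of a set is $f'f:f^{-1}(X'\cap Y)\to f'(X'\cap Y)$. An object of $\mathsf{D}_{\mathcal{G},\tau(x)}(A)$ is a triple $(I,\gamma_{\tau(x)},\gamma_{(x)})$ where: $I=\{I_y\}_{y\in\mathcal{G}_0}$ is a family of ideals of $A$; $\gamma_{\tau(x)}=\{\gamma_{\tau_y}:I_{\tau_y^{-1}}\to I_{\tau_y}\}_{y\in\mathcal{G}_0}$ is a family of ring isomorphisms with $I_{\tau_y^{-1}}$ an ideal of $I_x$, $I_{\tau_y}$ an ideal of $I_y$, and $\gamma_{\tau_x}=\gamma_x=\mathrm{id}_{I_x}$; $\gamma_{(x)}=(I_h,\gamma_h)_{h\in\mathcal{G}(x)}$ is a partial action of the group $\mathcal{G}(x)$ on $I_x$; and for all $g\in\mathcal{G}$ the set $\gamma_{\tau_{t(g)}}\big(I_{\tau_{t(g)}^{-1}}\cap\gamma_{g_x}(I_{\tau_{s(g)}^{-1}}\cap I_{g_x^{-1}})\big)$ is an ideal of $I_{t(g)}$. $\mathtt{Ext}(\gamma)$ is the partial action $\theta=(B_g,\theta_g)_{g\in\mathcal{G}}$ of $\mathcal{G}$ on $A$ with $\theta_y=\mathrm{id}_{I_y}$ for $y\in\mathcal{G}_0$, $\theta_g=\gamma_{\tau_{t(g)}}\gamma_{g_x}\gamma_{\tau_{s(g)}}^{-1}$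 (composition of partial bijections) for $g\notin\mathcal{G}_0$, and $B_g$ the range of $\theta_g$. In the present setting each $B_g$ is unital, and its identity $1_g=\gamma_{\tau_{t(g)}}(1_{g_x})$ is a central idempotent of $A$ with $B_g=A1_g$; moreover $\theta_{(x)}=\gamma_{(x)}$ and $B_x=I_x$. Invariants and traces: $A^\theta=\{a\in A:\theta_g(a1_{g^{-1}})=a1_g\ \forall g\in\mathcal{G}\}$, $B_x^{\theta_{(x)}}=\{b\in B_x:\theta_h(b1_{h^{-1}})=b1_h\ \forall h\in\mathcal{G}(x)\}$; $t_\theta(a)=\sum_{g\in\mathcal{G}}\theta_g(a1_{g^{-1}})\in A^\theta$ for $a\in A$, $t_{\theta_{(x)}}(b)=\sum_{h\in\mathcal{G}(x)}\theta_h(b1_{h^{-1}})\in B_x^{\theta_{(x)}}$ for $b\in B_x$. Partial Galois extension: $A$ is a $\theta$-partial Galois extension of $A^\theta$ if there exist $r\ge1$ and $a_i,b_i\in A$, $1\le i\le r$, such that for every $g\in\mathcal{G}$, $\sum_{i=1}^ra_i\theta_g(b_i1_{g^{-1}})$ equals $1_y$ if $g=y\in\mathcal{G}_0$ and equals $0$ if $g\notin\mathcal{G}_0$. The notion for $\theta_{(x)}$ acting on $B_x$ is the same one applied to the one-object groupoid $\mathcal{G}(x)$. The partial skew groupoid ring $R=A\star_\theta\mathcal{G}$ is the set of formal sums $\sum_{g\in\mathcal{G}}b_g\delta_g$, $b_g\in B_g$, with the usual addition and multiplication determined by $(b_g\delta_g)(b'_h\delta_h)=b_g\theta_g(b'_h1_{g^{-1}})\delta_{gh}$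 if $s(g)=t(h)$ and $0$ otherwise; $B_x\star_{\theta_{(x)}}\mathcal{G}(x)$ is defined in the same way from $\theta_{(x)}$. $A$ is an $(A^\theta,R)$-bimodule and an $(R,A^\theta)$-bimodule: $A^\theta$ acts by multiplication, and $R$ acts by $a\delta_g\cdot b=a\theta_g(b1_{g^{-1}})$ and $b\cdot a\delta_g=\theta_{g^{-1}}(ba)$ for $a\in B_g$, $b\in A$. The bimodule maps are $\Gamma:A\otimes_RA\to A^\theta$, $a\otimes b\mapsto t_\theta(ab)$, and $\Gamma':A\otimes_{A^\theta}A\to R$, $a\otimes b\mapsto\sum_{g\in\mathcal{G}}a\theta_g(b1_{g^{-1}})\delta_g$. The maps $\Gamma_x:B_x\otimes_{B_x\star_{\theta_{(x)}}\mathcal{G}(x)}B_x\to B_x^{\theta_{(x)}}$ and $\Gamma'_x:B_x\otimes_{B_x^{\theta_{(x)}}}B_x\to B_x\star_{\theta_{(x)}}\mathcal{G}(x)$ are defined in the same way for the partial action $\theta_{(x)}$ of $\mathcal{G}(x)$ on $B_x$. The sixtuples in (ii) and (iii) are Morita contexts; a Morita context is strict if its two bimodule maps are isomorphisms. *)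

(* Defs.v *)
From HB Require Import structures.
From mathcomp Require Import all_boot all_algebra.
From mathcomp Require Import generic_quotient ring_quotient.
From mathcomp Require Import boolp classical_sets functions.
From mathcomp Require Import freeg.

Set Implicit Arguments.
Unset Strict Implicit.
Unset Printing Implicit Defensive.

Import GRing.Theory.

Local Open Scope classical_set_scope.
Local Open Scope ring_scope.
Local Open Scope quotient_scope.

Declare Scope rng_scope.
Delimit Scope rng_scope with rng.

(* Associative rings, not necessarily unital. *)
HB.mixin Record Zmodule_isRng A of GRing.Zmodule A := {
  rngmul : A -> A -> A;
  rngmulA : associative rngmul;
  rngmulDl : left_distributive rngmul +%R;
  rngmulDr : right_distributive rngmul +%R
}.

#[short(type="rngType")]
HB.structure Definition Rng := {A of Zmodule_isRng A & GRing.Zmodule A}.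

Notation "a ** b" := (rngmul a b)
  (at level 40, left associativity) : rng_scope.
Open Scope rng_scope.

(* Rings, ideals and modules that live inside an ambient additive group are   *)
(* represented by subsets of it; functions between them are functions on the  *)
(* ambient group, whose values outside the relevant subset are irrelevant.    *)

Definition subgroup_set (V : zmodType) (X : set V) : Prop :=
  X 0 /\ (forall u v, X u -> X v -> X (u - v)).

Definition biadditive_on (U V W : zmodType) (X : set U) (Y : set V) (Z : set W)
    (f : U -> V -> W) : Prop :=
  [/\ forall u v, X u -> Y v -> Z (f u v),
      forall u u' v, X u -> X u' -> Y v -> f (u + u') v = f u v + f u' v
    & forall u v v', X u -> Y v -> Y v' -> f u (v + v') = f u v + f u v'].

Section Rings.

Variable A : rngType.
Implicit Types (I J X Y : set A) (f : A -> A).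

Definition ideal_of J I : Prop :=
  [/\ I `<=` J, subgroup_set I
    & forall a b, J a -> I b -> I (a ** b) /\ I (b ** a)].

Definition rng_iso X Y f : Prop :=
  [/\ set_bij X Y f,
      forall a b, X a -> X b -> f (a + b) = f a + f b
    & forall a b, X a -> X b -> f (a ** b) = f a ** f b].

Definition is_identity I (e : A) : Prop :=
  I e /\ (forall a, I a -> e ** a = a /\ a ** e = a).

Definition unital_set I : Prop := exists e, is_identity I e.

(* the identity element of I, and 0 if I is not unital *)
Definition identity_of I : A := xget 0 [set e | is_identity I e].

Definition direct_sum_of (T : finType) (F : T -> set A) : Prop :=
  forall a, exists! f : {ffun T -> A},
    (forall y, F y (f y)) /\ a = \sum_(y : T) f y.

(* Partial bijections of A, given by their domain and their values on it. *)
Record pbij := PBij { pb_dom : set A; pb_fun : A -> A }.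

Definition pb_range (f : pbij) : set A := pb_fun f @` pb_dom f.

Definition pb_comp (f' f : pbij) : pbij :=
  PBij (pb_dom f `&` pb_fun f @^-1` pb_dom f') (pb_fun f' \o pb_fun f).

Definition pb_inv (f : pbij) : pbij :=
  PBij (pb_range f)
       (fun b => xget 0 [set a | pb_dom f a /\ pb_fun f a = b]).

Definition pb_id (X : set A) : pbij := PBij X id.

End Rings.

(* Finite groupoids. gcomp g h is the composite gh ("h, then g"); it is a     *)
(* total function, meaningful only when gsrc g = gtgt h.                      *)
Record groupoid := Groupoid {
  gobj : finType;
  gmor :> finType;
  gsrc : gmor -> gobj;
  gtgt : gmor -> gobj;
  gid : gobj -> gmor;
  ginv : gmor -> gmor;
  gcomp : gmor -> gmor -> gmor;
  gsrc_id : forall y, gsrc (gid y) = y;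
  gtgt_id : forall y, gtgt (gid y) = y;
  gsrc_inv : forall g, gsrc (ginv g) = gtgt g;
  gtgt_inv : forall g, gtgt (ginv g) = gsrc g;
  gsrc_comp : forall g h, gsrc g = gtgt h -> gsrc (gcomp g h) = gsrc h;
  gtgt_comp : forall g h, gsrc g = gtgt h -> gtgt (gcomp g h) = gtgt g;
  gcompA : forall f g h, gsrc f = gtgt g -> gsrc g = gtgt h ->
    gcomp f (gcomp g h) = gcomp (gcomp f g) h;
  gcomp1l : forall g, gcomp (gid (gtgt g)) g = g;
  gcomp1r : forall g, gcomp g (gid (gsrc g)) = g;
  gcompVl : forall g, gcomp (ginv g) g = gid (gsrc g);
  gcompVr : forall g, gcomp g (ginv g) = gid (gtgt g)
}.

Definition gconnected (G : groupoid) : Prop :=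
  forall y z : gobj G, exists g : G, gsrc g = y /\ gtgt g = z.

Section Isotropy.

Variables (G : groupoid) (x : gobj G).

Definition is_loop (g : G) : bool := (gsrc g == x) && (gtgt g == x).

Definition loop := {g : G | is_loop g}.

Lemma is_loop_id : is_loop (gid x).
Proof. by rewrite /is_loop gsrc_id gtgt_id eqxx. Qed.

Lemma is_loop_inv (g : loop) : is_loop (ginv (val g)).
Proof.
by case: g => g /= /andP[sg tg]; rewrite /is_loop gsrc_inv gtgt_inv tg sg.
Qed.

Lemma loop_composable (g h : loop) : gsrc (val g) = gtgt (val h).
Proof. by case: g h => [g /andP[/eqP sg _]] [h /andP[_ /eqP th]] /=; rewrite sg th. Qed.

Lemma is_loop_comp (g h : loop) : is_loop (gcomp (val g) (val h)).
Proof.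
have gh := loop_composable g h; rewrite /is_loop gsrc_comp // gtgt_comp //.
by case: g h {gh} => [g /andP[_ tg]] [h /andP[sh _]] /=; rewrite sh tg.
Qed.

Definition loop_id : loop := Sub (gid x) is_loop_id.
Definition loop_inv (g : loop) : loop := Sub _ (is_loop_inv g).
Definition loop_comp (g h : loop) : loop := Sub _ (is_loop_comp g h).

(* The isotropy group of x, as a one-object groupoid. *)
Definition isotropy : groupoid.
Proof.
refine (@Groupoid unit loop (fun=> tt) (fun=> tt) (fun=> loop_id)
  loop_inv loop_comp _ _ _ _ _ _ _ _ _ _ _) => //.
- by case.
- by case.
- by move=> f g h _ _; apply: val_inj; rewrite /= gcompA //; exact: loop_composable.
- by move=> [g lg]; apply: val_inj => /=; case/andP: lg => _ /eqP <-; rewrite gcomp1l.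
- by move=> [g lg]; apply: val_inj => /=; case/andP: lg => /eqP <- _; rewrite gcomp1r.
- by move=> [g lg]; apply: val_inj => /=; rewrite gcompVl; case/andP: lg => /eqP ->.
- by move=> [g lg]; apply: val_inj => /=; rewrite gcompVr; case/andP: lg => _ /eqP ->.
Defined.

Record gtransversal := GTransversal {
  tau :> gobj G -> G;
  gsrc_tau : forall y, gsrc (tau y) = x;
  gtgt_tau : forall y, gtgt (tau y) = y;
  tau_base : tau x = gid x
}.

Lemma is_loop_conj (t : gtransversal) (g : G) :
  is_loop (gcomp (ginv (t (gtgt g))) (gcomp g (t (gsrc g)))).
Proof.
have e1 : gsrc g = gtgt (t (gsrc g)) by rewrite gtgt_tau.
have e2 : gsrc (ginv (t (gtgt g))) = gtgt (gcomp g (t (gsrc g))).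
  by rewrite gsrc_inv gtgt_tau gtgt_comp.
by rewrite /is_loop gsrc_comp // gsrc_comp // gtgt_comp // gtgt_inv !gsrc_tau eqxx.
Qed.

Definition loop_conj (t : gtransversal) (g : G) : isotropy :=
  (Sub _ (is_loop_conj t g) : loop).

End Isotropy.

(* The data of a partial action of G on the ring pa_ring, a subset of A. *)
Record paction (G : groupoid) (A : rngType) := PAction {
  pa_ring : set A;
  pa_dom : G -> set A;
  pa_fun : G -> A -> A
}.

Section PartialActions.

Variables (G : groupoid) (A : rngType).
Implicit Types (al : paction G A).

(* alpha_h^-1 (A_{g^-1} \cap A_h) *)
Definition pa_comp_dom al (g h : G) : set A :=
  [set a | pa_dom al (ginv h) a /\
           (pa_dom al (ginv g) `&` pa_dom al h) (pa_fun al h a)].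

Definition is_paction al : Prop :=
  [/\ forall g,
        [/\ ideal_of (pa_ring al) (pa_dom al (gid (gtgt g))),
            ideal_of (pa_dom al (gid (gtgt g))) (pa_dom al g)
          & rng_iso (pa_dom al (ginv g)) (pa_dom al g) (pa_fun al g)],
      forall y a, pa_dom al (gid y) a -> pa_fun al (gid y) a = a,
      forall g h, gsrc g = gtgt h ->
        pa_comp_dom al g h `<=` pa_dom al (ginv (gcomp g h))
    & forall g h a, gsrc g = gtgt h -> pa_comp_dom al g h a ->
        pa_fun al g (pa_fun al h a) = pa_fun al (gcomp g h) a].

Definition unital_paction al : Prop := forall g, unital_set (pa_dom al g).

End PartialActions.

(* Partial actions of the isotropy group of x on the ring J. *)
Definition is_group_paction (G : groupoid) (x : gobj G) (A : rngType)
    (J : set A) (al : paction (isotropy x) A) : Prop :=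
  [/\ is_paction al, pa_ring al = J & pa_dom al (gid (tt : gobj (isotropy x))) = J].

(* The data (I, gamma_tau(x), gamma_(x)) of an object of D_{G,tau(x)}(A):     *)
(* dI y = I_y, dItau y = I_{tau_y}, dItauV y = I_{tau_y^-1},                  *)
(* dtau y = gamma_{tau_y} and diso = gamma_(x).                               *)
Record ddata (G : groupoid) (x : gobj G) (A : rngType) := DData {
  dI : gobj G -> set A;
  dItau : gobj G -> set A;
  dItauV : gobj G -> set A;
  dtau : gobj G -> A -> A;
  diso : paction (isotropy x) A
}.

Section Extension.

Variables (G : groupoid) (x : gobj G) (t : gtransversal x) (A : rngType).
Implicit Types (ga : ddata x A).

Definition is_dobject ga : Prop :=
  [/\ forall y, ideal_of setT (dI ga y),
      forall y, [/\ ideal_of (dI ga x) (dItauV ga y),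
                    ideal_of (dI ga y) (dItau ga y)
                  & rng_iso (dItauV ga y) (dItau ga y) (dtau ga y)],
      [/\ dItauV ga x = dI ga x, dItau ga x = dI ga x
        & forall a, dI ga x a -> dtau ga x a = a],
      is_group_paction (dI ga x) (diso ga)
    & forall g : G,
        let gx := loop_conj t g in
        ideal_of (dI ga (gtgt g))
          (dtau ga (gtgt g) @`
             (dItauV ga (gtgt g) `&`
              pa_fun (diso ga) gx @`
                (dItauV ga (gsrc g) `&` pa_dom (diso ga) (ginv gx))))].

Definition dtau_pbij ga (y : gobj G) : pbij A :=
  PBij (dItauV ga y) (dtau ga y).

Definition diso_pbij ga (h : isotropy x) : pbij A :=
  PBij (pa_dom (diso ga) (ginv h)) (pa_fun (diso ga) h).

Definition Ext_pbij ga (g : G) : pbij A :=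
  if g == gid (gsrc g) then pb_id (dI ga (gsrc g))
  else pb_comp (dtau_pbij ga (gtgt g))
         (pb_comp (diso_pbij ga (loop_conj t g))
                  (pb_inv (dtau_pbij ga (gsrc g)))).

Definition Ext ga : paction G A :=
  PAction setT (fun g => pb_range (Ext_pbij ga g))
               (fun g => pb_fun (Ext_pbij ga g)).

End Extension.

(* The restriction theta_(x) of theta to the isotropy group of x. *)
Definition isotropy_restr (G : groupoid) (x : gobj G) (A : rngType)
    (th : paction G A) : paction (isotropy x) A :=
  @PAction (isotropy x) A (pa_dom th (gid x))
    (fun h => pa_dom th (val h)) (fun h => pa_fun th (val h)).

Section Invariants.

Variables (G : groupoid) (A : rngType) (th : paction G A).

Definition pa_one (g : G) : A := identity_of (pa_dom th g).

(* theta_g (a 1_{g^-1}) *)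
Definition pa_twist (g : G) (a : A) : A := pa_fun th g (a ** pa_one (ginv g)).

Definition pa_invariants : set A :=
  [set a | pa_ring th a /\ forall g, pa_twist g a = a ** pa_one g].

Definition pa_trace (a : A) : A := \sum_(g : G) pa_twist g a.

Definition pa_trace_onto : Prop := set_surj (pa_ring th) pa_invariants pa_trace.

Definition pa_galois : Prop :=
  exists r : nat, (1 <= r)%N /\
  exists a b : 'I_r -> A,
    [/\ forall i, pa_ring th (a i), forall i, pa_ring th (b i),
        forall y : gobj G, \sum_i a i ** pa_twist (gid y) (b i) = pa_one (gid y)
      & forall g : G, (forall y, g <> gid y) ->
          \sum_i a i ** pa_twist g (b i) = 0].

(* The partial skew groupoid ring: the formal sum of the b_g delta_g is the   *)
(* finite function g |-> b_g.                                                 *)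
Definition skew : set {ffun G -> A} :=
  [set f | forall g, pa_dom th g (f g)].

Definition skew_mul (f f' : {ffun G -> A}) : {ffun G -> A} :=
  [ffun k => \sum_(g : G)
     \sum_(h : G | (gsrc g == gtgt h) && (gcomp g h == k)) f g ** pa_twist g (f' h)].

Definition skew_actl (f : {ffun G -> A}) (b : A) : A :=
  \sum_(g : G) f g ** pa_twist g b.

Definition skew_actr (b : A) (f : {ffun G -> A}) : A :=
  \sum_(g : G) pa_fun th (ginv g) (b ** f g).

Definition Gam (a b : A) : A := pa_trace (a ** b).

Definition Gam' (a b : A) : {ffun G -> A} := [ffun g => a ** pa_twist g b].

End Invariants.

Inductive generated (V : zmodType) (E : set V) : V -> Prop :=
| generated_in v : E v -> generated E v
| generated_0 : generated E 0
| generated_B u v : generated E u -> generated E v -> generated E (u - v).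

Definition generated_pred (V : zmodType) (E : set V) : {pred V} :=
  fun v => `[< generated E v >].

Lemma generated_zmod_closed (V : zmodType) (E : set V) :
  zmod_closed (generated_pred E).
Proof.
split; first exact/asboolP/generated_0.
by move=> u v /asboolP Eu /asboolP Ev; apply/asboolP/generated_B.
Qed.

HB.instance Definition _ (V : zmodType) (E : set V) :=
  GRing.isZmodClosed.Build V (generated_pred E) (generated_zmod_closed E).

Section Tensor.

Variables (M N R : zmodType) (XM : set M) (XN : set N) (XR : set R).
Variables (ract : M -> R -> M) (lact : R -> N -> N).

Local Notation free := {freeg (XM * XN)%type}.

Inductive tensor_relator : free -> Prop :=
| tensor_addl (m m1 m2 : XM) (n : XN) : val m = val m1 + val m2 ->
    tensor_relator (<< (m, n) >> - (<< (m1, n) >> + << (m2, n) >>))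
| tensor_addr (m : XM) (n n1 n2 : XN) : val n = val n1 + val n2 ->
    tensor_relator (<< (m, n) >> - (<< (m, n1) >> + << (m, n2) >>))
| tensor_bal (m m' : XM) (n n' : XN) (r : R) : XR r ->
    val m' = ract (val m) r -> val n' = lact r (val n) ->
    tensor_relator (<< (m', n) >> - << (m, n') >>).

(* The tensor product over XR of the right XR-module XM and the left          *)
(* XR-module XN, as a quotient of the free abelian group on XM * XN.          *)
Definition tensor : zmodType := Quotient.quot (generated_pred tensor_relator).

Definition pure (m : XM) (n : XN) : tensor := \pi_tensor << (m, n) >>.

(* The map from the tensor product to the subset Z of S given by              *)
(* m (x) n |-> f m n is well defined and bijective.                           *)
Definition tensor_bij (S : zmodType) (Z : set S) (f : M -> N -> S) : Prop :=
  exists F : {additive tensor -> S},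
    (forall m n, F (pure m n) = f (val m) (val n)) /\ set_bij setT Z F.

End Tensor.

Record rng_data := RngData {
  rd_amb : zmodType;
  rd_set : set rd_amb;
  rd_mul : rd_amb -> rd_amb -> rd_amb
}.

Arguments rd_set : clear implicits.

Record zmod_data := ZmodData { zd_amb : zmodType; zd_set : set zd_amb }.

Arguments zd_set : clear implicits.

Definition is_rng (S : rng_data) : Prop :=
  [/\ subgroup_set (rd_set S),
      biadditive_on (rd_set S) (rd_set S) (rd_set S) (@rd_mul S)
    & forall a b c, rd_set S a -> rd_set S b -> rd_set S c ->
        rd_mul a (rd_mul b c) = rd_mul (rd_mul a b) c].

Definition is_bimodule (S R : rng_data) (M : zmod_data)
    (al : rd_amb S -> zd_amb M -> zd_amb M)
    (ar : zd_amb M -> rd_amb R -> zd_amb M) : Prop :=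
  [/\ subgroup_set (zd_set M),
      biadditive_on (rd_set S) (zd_set M) (zd_set M) al
      /\ biadditive_on (zd_set M) (rd_set R) (zd_set M) ar,
      forall s s' m, rd_set S s -> rd_set S s' -> zd_set M m ->
        al (rd_mul s s') m = al s (al s' m),
      forall m r r', zd_set M m -> rd_set R r -> rd_set R r' ->
        ar m (rd_mul r r') = ar (ar m r) r'
    & forall s m r, rd_set S s -> zd_set M m -> rd_set R r ->
        ar (al s m) r = al s (ar m r)].

(* f induces a map of (S, S)-bimodules from M (x)_R N to S. *)
Definition is_bimodule_map (S R : rng_data) (M N : zmod_data)
    (SM : rd_amb S -> zd_amb M -> zd_amb M)
    (MR : zd_amb M -> rd_amb R -> zd_amb M)
    (RN : rd_amb R -> zd_amb N -> zd_amb N)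
    (NS : zd_amb N -> rd_amb S -> zd_amb N)
    (f : zd_amb M -> zd_amb N -> rd_amb S) : Prop :=
  [/\ biadditive_on (zd_set M) (zd_set N) (rd_set S) f,
      forall m r n, zd_set M m -> rd_set R r -> zd_set N n ->
        f (MR m r) n = f m (RN r n),
      forall s m n, rd_set S s -> zd_set M m -> zd_set N n ->
        f (SM s m) n = rd_mul s (f m n)
    & forall m n s, zd_set M m -> zd_set N n -> rd_set S s ->
        f m (NS n s) = rd_mul (f m n) s].

(* The data of a sixtuple (S, R, M, N, mc_f, mc_g), with mc_f and mc_g given  *)
(* by their values on the elements m (x) n and n (x) m.                       *)
Record morita_data := MoritaData {
  mc_S : rng_data;
  mc_R : rng_data;
  mc_M : zmod_data;
  mc_N : zmod_data;
  mc_SM : rd_amb mc_S -> zd_amb mc_M -> zd_amb mc_M;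
  mc_MR : zd_amb mc_M -> rd_amb mc_R -> zd_amb mc_M;
  mc_RN : rd_amb mc_R -> zd_amb mc_N -> zd_amb mc_N;
  mc_NS : zd_amb mc_N -> rd_amb mc_S -> zd_amb mc_N;
  mc_f : zd_amb mc_M -> zd_amb mc_N -> rd_amb mc_S;
  mc_g : zd_amb mc_N -> zd_amb mc_M -> rd_amb mc_R
}.

Definition is_morita_context (C : morita_data) : Prop :=
  [/\ is_rng (mc_S C) /\ is_rng (mc_R C),
      is_bimodule (@mc_SM C) (@mc_MR C) /\ is_bimodule (@mc_RN C) (@mc_NS C),
      is_bimodule_map (@mc_SM C) (@mc_MR C) (@mc_RN C) (@mc_NS C) (@mc_f C)
      /\ is_bimodule_map (@mc_RN C) (@mc_NS C) (@mc_SM C) (@mc_MR C) (@mc_g C),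
      forall m n m', zd_set (mc_M C) m -> zd_set (mc_N C) n ->
        zd_set (mc_M C) m' -> mc_SM (mc_f m n) m' = mc_MR m (mc_g n m')
    & forall n m n', zd_set (mc_N C) n -> zd_set (mc_M C) m ->
        zd_set (mc_N C) n' -> mc_RN (mc_g n m) n' = mc_NS n (mc_f m n')].

Definition strict_morita_context (C : morita_data) : Prop :=
  [/\ is_morita_context C,
      tensor_bij (zd_set (mc_M C)) (zd_set (mc_N C)) (rd_set (mc_R C))
        (@mc_MR C) (@mc_RN C) (rd_set (mc_S C)) (@mc_f C)
    & tensor_bij (zd_set (mc_N C)) (zd_set (mc_M C)) (rd_set (mc_S C))
        (@mc_NS C) (@mc_SM C) (rd_set (mc_R C)) (@mc_g C)].

Definition galois_context (G : groupoid) (A : rngType) (th : paction G A) :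
    morita_data :=
  @MoritaData
    (@RngData A (pa_invariants th) (@rngmul A))
    (@RngData {ffun G -> A} (skew th) (skew_mul th))
    (@ZmodData A (pa_ring th))
    (@ZmodData A (pa_ring th))
    (@rngmul A) (skew_actr th) (skew_actl th) (@rngmul A)
    (Gam th) (Gam' th).

(* Main.v *)
(* Idea. Write T_g a = theta_g (a 1_{g^-1}); a unital partial action is           *)
(* encoded by the central idempotents 1_g and the maps T_g, which satisfy         *)
(* T_g T_h a = T_{gh} a 1_g when s(g) = t(h). From these identities the sixtuple  *)
(* of theta is a Morita context; being a context between unital rings, it is      *)
(* strict as soon as Gamma and Gamma' hit the identities. For Gamma this means    *)
(* that the trace is onto, for Gamma' that there are partial Galois coordinates,  *)
(* whence (i) <-> (ii) and (iii) <-> (iv). Finally, a |-> a 1_x is a bijection    *)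
(* from A^theta onto B_x^theta_(x) with inverse b |-> \sum_y theta_{tau_y} b,      *)
(* compatible with the traces, and (a_i, b_i) |-> (theta_{tau_y} a_i,             *)
(* theta_{tau_y} b_i) turns Galois coordinates for theta_(x) into Galois          *)
(* coordinates for theta, so that (i) <-> (iv).                                   *)
From HB Require Import structures.
From mathcomp Require Import all_boot all_algebra generic_quotient ring_quotient.
From mathcomp Require Import boolp classical_sets functions freeg.
Require Import Defs.

Set Implicit Arguments.
Unset Strict Implicit.
Unset Printing Implicit Defensive.

Import GRing.Theory.

Local Open Scope classical_set_scope.
Local Open Scope ring_scope.
Local Open Scope quotient_scope.

(** Throughout, T_g stands for [pa_twist th g], 1_g for [pa_one th g], and 1 for [pa_unit th]. The
    record [twisted] isolates the identities between the 1_g and the T_g on which every later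
    computation rests. It holds for any unital partial action whose object identities 1_y are
    orthogonal and add up to an identity of the ring ([twisted_paction]), hence for gamma_(x). It is
    transported to theta by the formula T_g = gamma_{tau_{t(g)}} K_{g_x} R_{s(g)} of [Ext_twistE],
    because g |-> g_x respects composition ([twisted_Ext]). It restricts to theta_(x)
    ([twisted_restr]), so general results apply to both partial actions.

    Two things are then shown. For any [twisted] partial action, strictness of the context means
    Galois coordinates together with a surjective trace ([strict_galois], [galois_strict]):
    surjectivity of the two maps provides preimages of the identities, and conversely such preimages
    make both maps bijective ([morita_tensor_bij]). Second, the Galois condition and surjectivity of
    the trace pass between theta and theta_(x). The bridge is theta_g theta_{tau_{s(g)}} =
    theta_{tau_{t(g)}} theta_{g_x} ([twist_tau_loop]), valid since the theta_{tau_y} are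
    isomorphisms from all of B_x onto all of B_y; it gives [galois_extend] and [invariant_extend],
    while [trace_mul_one] and [sum_tau_trace] compare the traces. *)

(** * Non-unital rings, subgroups and biadditive maps *)

Section RngTheory.

Variable A : rngType.
Implicit Types a b c : A.

Lemma rngmul0l a : 0 ** a = 0.
Proof. by apply: (addrI (0 ** a)); rewrite -rngmulDl !addr0. Qed.

Lemma rngmul0r a : a ** 0 = 0.
Proof. by apply: (addrI (a ** 0)); rewrite -rngmulDr !addr0. Qed.

Lemma rngmulNl a b : (- a) ** b = - (a ** b).
Proof. by apply/eqP; rewrite -addr_eq0 -rngmulDl addNr rngmul0l. Qed.

Lemma rngmulBl a b c : (a - b) ** c = a ** c - b ** c.
Proof. by rewrite rngmulDl rngmulNl. Qed.

Lemma rngmul_suml (I : Type) (r : seq I) (P : pred I) (F : I -> A) a :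
  (\sum_(i <- r | P i) F i) ** a = \sum_(i <- r | P i) F i ** a.
Proof.
by apply: (big_morph (fun b => b ** a)) => [b c|]; rewrite ?rngmulDl ?rngmul0l.
Qed.

Lemma rngmul_sumr (I : Type) (r : seq I) (P : pred I) (F : I -> A) a :
  a ** (\sum_(i <- r | P i) F i) = \sum_(i <- r | P i) a ** F i.
Proof.
by apply: (big_morph (fun b => a ** b)) => [b c|]; rewrite ?rngmulDr ?rngmul0r.
Qed.

End RngTheory.

Section SubgroupSet.

Variables (V : zmodType) (X : set V).
Hypothesis subX : subgroup_set X.

Lemma subgroup_set0 : X 0. Proof. by case: subX. Qed.

Lemma subgroup_setB u v : X u -> X v -> X (u - v).
Proof. by case: subX => _; apply. Qed.

Lemma subgroup_setN u : X u -> X (- u).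
Proof. by move=> Xu; rewrite -sub0r; apply: subgroup_setB; first exact: subgroup_set0. Qed.

Lemma subgroup_setD u v : X u -> X v -> X (u + v).
Proof. by move=> Xu Xv; rewrite -[v]opprK; apply/subgroup_setB/subgroup_setN. Qed.

Lemma subgroup_set_sum (I : Type) (r : seq I) (P : pred I) (F : I -> V) :
  (forall i, P i -> X (F i)) -> X (\sum_(i <- r | P i) F i).
Proof.
by move=> XF; elim/big_ind: _ => //; [exact: subgroup_set0 | exact: subgroup_setD].
Qed.

End SubgroupSet.

Section Biadditive.

Variables (U V W : zmodType) (X : set U) (Y : set V) (Z : set W) (f : U -> V -> W).
Hypotheses (subX : subgroup_set X) (subY : subgroup_set Y).
Hypothesis f_biadd : biadditive_on X Y Z f.

Lemma biadditive0l v : Y v -> f 0 v = 0.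
Proof.
case: f_biadd => _ fD _ Yv; have X0 := subgroup_set0 subX.
by apply: (addrI (f 0 v)); rewrite -fD // !addr0.
Qed.

Lemma biadditiveNl u v : X u -> Y v -> f (- u) v = - f u v.
Proof.
case: f_biadd => _ fD _ Xu Yv; apply/eqP; rewrite -addr_eq0 -fD ?addNr //.
  by rewrite biadditive0l.
exact: subgroup_setN.
Qed.

Lemma biadditive0r u : X u -> f u 0 = 0.
Proof.
case: f_biadd => _ _ fD Xu; have Y0 := subgroup_set0 subY.
by apply: (addrI (f u 0)); rewrite -fD // !addr0.
Qed.

Lemma biadditive_sumr (I : Type) (r : seq I) (F : I -> V) u :
  X u -> (forall i, Y (F i)) -> f u (\sum_(i <- r) F i) = \sum_(i <- r) f u (F i).
Proof.
move=> Xu YF; elim: r => [|i r IHr]; first by rewrite !big_nil biadditive0r.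
rewrite !big_cons -IHr; case: f_biadd => _ _ -> //.
by apply: subgroup_set_sum.
Qed.

End Biadditive.

(** * Tensor products over subsets: induction and universal property *)

Section TensorTheory.

Variables (M N R : zmodType) (XM : set M) (XN : set N) (XR : set R).
Variables (ract : M -> R -> M) (lact : R -> N -> N).

Local Notation T := (tensor XM XN XR ract lact).
Local Notation pure := (pure XR ract lact).
Local Notation relator := (tensor_relator XR ract lact).

Lemma pi_tensorE (v w : {freeg (XM * XN)%type}) :
  generated relator (v - w) -> \pi_T v = \pi_T w.
Proof. by move=> vw; apply/eqP; rewrite -Quotient.idealrBE; apply/asboolP. Qed.

(** Every tensor is the class of an integer combination of generators, and subtraction already
    yields negatives, sums and integer multiples. *)
Lemma tensor_ind (P : T -> Prop) :
  P 0 -> (forall m n, P (pure m n)) -> (forall u v, P u -> P v -> P (u - v)) ->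
  forall u, P u.
Proof.
move=> P0 Pp PB u.
have PN v : P v -> P (- v) by move=> Pv; rewrite -sub0r; apply: PB.
have PD v w : P v -> P w -> P (v + w).
  by move=> Pv Pw; rewrite -[w]opprK; apply/PB/PN.
rewrite -[u]reprK -[repr u]freeg_sumE raddf_sum; elim/big_ind: _ => // -[m n] _.
rewrite -[coeff _ _]intz -freegU_mulz raddfMz -/(pure m n).
have Pn k : P (pure m n *+ k).
  by elim: k => [|k IHk]; rewrite ?mulr0n // mulrS; apply: PD.
by case: (coeff _ _) => k; rewrite ?NegzE -?nmulrn -?pmulrn //; apply: PN.
Qed.

Lemma pure_addl (m m1 m2 : XM) (n : XN) :
  val m = val m1 + val m2 -> pure m n = pure m1 n + pure m2 n.
Proof. by move=> mE; rewrite -raddfD; apply/pi_tensorE/generated_in/tensor_addl. Qed.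

Lemma pure_addr (m : XM) (n n1 n2 : XN) :
  val n = val n1 + val n2 -> pure m n = pure m n1 + pure m n2.
Proof. by move=> nE; rewrite -raddfD; apply/pi_tensorE/generated_in/tensor_addr. Qed.

Lemma pure_bal (m m' : XM) (n n' : XN) (r : R) :
  XR r -> val m' = ract (val m) r -> val n' = lact r (val n) ->
  pure m' n = pure m n'.
Proof. by move=> Xr m'E n'E; apply/pi_tensorE/generated_in/(tensor_bal Xr). Qed.

Section Lift.

Variables (S : zmodType) (f : M -> N -> S) (Z : set S).
Hypothesis f_biadd : biadditive_on XM XN Z f.
Hypothesis f_bal : forall m r n, XM m -> XR r -> XN n -> f (ract m r) n = f m (lact r n).

Let f_free (v : {freeg (XM * XN)%type}) : S :=
  fglift (fun mn => f (val mn.1) (val mn.2) : zmodule S) v.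

Let f_freeB : {morph f_free : v w / v - w}.
Proof.
by move=> v w; have := lift_is_additive (fun mn => f (val mn.1) (val mn.2) : zmodule S) v w.
Qed.

Let f_free0 : f_free 0 = 0.
Proof. by rewrite -[X in f_free X](subrr 0) f_freeB subrr. Qed.

Let f_freeD : {morph f_free : v w / v + w}.
Proof.
by move=> v w; rewrite -[w in LHS]opprK -[- w]sub0r !f_freeB f_free0 sub0r opprK.
Qed.

Let f_free_pure m n : f_free << (m, n) >> = f (val m) (val n).
Proof. by rewrite /f_free liftU /= scalezrE mulr1z. Qed.

Let f_free_rel v : generated relator v -> f_free v = 0.
Proof.
case: f_biadd => _ fDl fDr.
elim=> [_ [m m1 m2 n mE|m n n1 n2 nE|m m' n n' r Xr m'E n'E]||u w _ fu _ fw].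
- rewrite f_freeB f_freeD !f_free_pure mE fDl ?subrr //; exact: set_valP.
- rewrite f_freeB f_freeD !f_free_pure nE fDr ?subrr //; exact: set_valP.
- rewrite f_freeB !f_free_pure m'E n'E f_bal ?subrr //; exact: set_valP.
- exact: f_free0.
- by rewrite f_freeB fu fw subrr.
Qed.

Let F (u : T) : S := f_free (repr u).

Let F_pi v : F (\pi_T v) = f_free v.
Proof.
apply/eqP; rewrite -subr_eq0 -f_freeB f_free_rel //; apply/asboolP.
by have := Quotient.idealrBE (generated_pred relator) (repr (\pi_T v)) v; rewrite reprK eqxx.
Qed.

(** The linear extension [f_free] of [f] to the free group kills all relators, so its value does not
    depend on the representative chosen by [repr]. *)
Lemma tensor_lift :
  exists F : {additive T -> S}, forall m n, F (pure m n) = f (val m) (val n).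
Proof.
have FB : zmod_morphism F.
  by move=> u v; rewrite -[u]reprK -[v]reprK -raddfB !F_pi f_freeB.
pose FM := GRing.isZmodMorphism.Build _ _ F FB.
pose Fa : {additive T -> S} := HB.pack F FM.
by exists Fa => m n; rewrite -f_free_pure -F_pi.
Qed.

End Lift.

(** Surjectivity on tensors becomes a statement about finite families in the modules; applied to an
    identity element it produces coordinates. Signs are absorbed into the left factor. *)
Lemma tensor_bij_sum (S : zmodType) (Z : set S) (f : M -> N -> S) z :
  subgroup_set XM -> subgroup_set XN -> biadditive_on XM XN Z f ->
  tensor_bij XM XN XR ract lact Z f -> Z z ->
  exists r (a : 'I_r -> M) (b : 'I_r -> N),
    [/\ forall i, XM (a i), forall i, XN (b i) & z = \sum_i f (a i) (b i)].
Proof.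
move=> subM subN f_biadd [F [Fpure [_ _ surjF]]] Zz.
have [u _ <-] := surjF z Zz.
elim/tensor_ind: u => [|m n|u v [r [a [b [Xa Xb FuE]]]] [r' [a' [b' [Xa' Xb' FvE]]]]].
- by exists 0%N, (fun=> 0), (fun=> 0); split=> [[]|[]|] //; rewrite raddf0 big_ord0.
- exists 1%N, (fun=> val m), (fun=> val n); rewrite big_ord1 Fpure.
  by split=> // _; exact: set_valP.
- exists (r + r')%N, (fun i => match fintype.split i with inl j => a j | inr j => - a' j end).
  exists (fun i => match fintype.split i with inl j => b j | inr j => b' j end); split.
  + by move=> i; case: (fintype.split i) => j //; apply: subgroup_setN.
  + by move=> i; case: (fintype.split i).
  + rewrite raddfB FuE FvE big_split_ord /=; congr (_ + _).
      by apply: eq_bigr => i _; rewrite -[lshift _ _]/(unsplit (inl i)) unsplitK.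
    rewrite -sumrN; apply: eq_bigr => i _.
    by rewrite -[rshift _ _]/(unsplit (inr i)) unsplitK (biadditiveNl subM f_biadd).
Qed.

End TensorTheory.

(** * Morita contexts: bijectivity from a preimage of the identity *)

Section Morita.

Implicit Types C : morita_data.

(** Exchanging the roles of the two rings lets one bijectivity lemma serve for both maps of a
    context. *)
Definition morita_swap C : morita_data :=
  @MoritaData (mc_R C) (mc_S C) (mc_N C) (mc_M C)
    (@mc_RN C) (@mc_NS C) (@mc_SM C) (@mc_MR C) (@mc_g C) (@mc_f C).

Lemma is_morita_context_swap C : is_morita_context C -> is_morita_context (morita_swap C).
Proof. by case=> [[? ?] [? ?] [? ?] ? ?]; split. Qed.

(* If [\sum_i f c_i d_i = 1] then [m (x) n = \sum_i m (x) n f(c_i, d_i)         *)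
(* = \sum_i m g(n, c_i) (x) d_i = \sum_i f(m, n) c_i (x) d_i], so a tensor is   *)
(* determined by its image under [f].                                          *)
Lemma morita_tensor_bij C (I : finType) (c : I -> zd_amb (mc_M C)) (d : I -> zd_amb (mc_N C)) :
  is_morita_context C ->
  (forall i, zd_set (mc_M C) (c i)) -> (forall i, zd_set (mc_N C) (d i)) ->
  (forall n, zd_set (mc_N C) n -> mc_NS n (\sum_i mc_f (c i) (d i)) = n) ->
  (forall s, rd_set (mc_S C) s -> rd_mul s (\sum_i mc_f (c i) (d i)) = s) ->
  tensor_bij (zd_set (mc_M C)) (zd_set (mc_N C)) (rd_set (mc_R C))
    (@mc_MR C) (@mc_RN C) (rd_set (mc_S C)) (@mc_f C).
Proof.
case=> [[[subS mulS _] [subR mulR _]]].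
case=> -[subM [SMb MRb] SMA MRA SMR] [subN [RNb NSb] RNA NSA RNS].
case=> -[fb fbal fS fNS] [gb gbal gR gMR] fg gf Mc Nd n1 s1.
have Sf m n : zd_set (mc_M C) m -> zd_set (mc_N C) n -> rd_set (mc_S C) (mc_f m n).
  by case: fb => + _ _; apply.
have Rg n m : zd_set (mc_M C) m -> zd_set (mc_N C) n -> rd_set (mc_R C) (mc_g n m).
  by case: gb => + _ _ Mm Nn; apply.
have MSM s m : rd_set (mc_S C) s -> zd_set (mc_M C) m -> zd_set (mc_M C) (mc_SM s m).
  by case: SMb => + _ _; apply.
have NRN r n : rd_set (mc_R C) r -> zd_set (mc_N C) n -> zd_set (mc_N C) (mc_RN r n).
  by case: RNb => + _ _; apply.
have [F Fpure] := tensor_lift fb fbal.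
(* Pure tensors take arguments in the subtypes; [toM] and [toN] coerce ambient elements, with value
   0 outside the modules. *)
pose M0 : zd_set (mc_M C) := SigSub (mem_set (subgroup_set0 subM)).
pose toM m : zd_set (mc_M C) := insubd M0 m.
pose N0 : zd_set (mc_N C) := SigSub (mem_set (subgroup_set0 subN)).
pose toN n : zd_set (mc_N C) := insubd N0 n.
have toME m : zd_set (mc_M C) m -> val (toM m) = m.
  by move=> Mm; rewrite insubdK //; exact: mem_set.
have toNE n : zd_set (mc_N C) n -> val (toN n) = n.
  by move=> Nn; rewrite insubdK //; exact: mem_set.
have MSMc s i : rd_set (mc_S C) s -> zd_set (mc_M C) (mc_SM s (c i)).
  by move=> Ss; apply: MSM.
have FE s : rd_set (mc_S C) s ->
    F (\sum_i pure _ _ _ (toM (mc_SM s (c i))) (toN (d i))) = s.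
  move=> Ss; rewrite raddf_sum -[RHS]s1 // (biadditive_sumr subS mulS) //; last first.
    by move=> i; apply: Sf.
  by apply: eq_bigr => i _; rewrite Fpure toME ?toNE ?fS //; apply: MSMc.
have S_F u : rd_set (mc_S C) (F u).
  elim/tensor_ind: u => [|m n|u v Su Sv].
  - by rewrite raddf0; apply: subgroup_set0.
  - by rewrite Fpure; apply: Sf; apply: set_valP.
  - by rewrite raddfB; apply: subgroup_setB.
(* This recovers [u] from [F u], hence injectivity; [FE] above is surjectivity. *)
have uE u : u = \sum_i pure _ _ _ (toM (mc_SM (F u) (c i))) (toN (d i)).
  elim/tensor_ind: u => [|m n|u v uE vE].
  - rewrite raddf0 big1 // => i _; apply: (addrI (pure _ _ _ (toM (mc_SM 0 (c i))) (toN (d i)))).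
    have S0 := subgroup_set0 subS.
    rewrite addr0; apply/esym/pure_addl.
    by rewrite (biadditive0l subS SMb) // toME ?addr0 //; apply: subgroup_set0.
  - have [Mm Nn] := (set_valP m, set_valP n).
    transitivity (\sum_i pure (rd_set (mc_R C)) (@mc_MR C) (@mc_RN C) m
        (toN (mc_RN (mc_g (val n) (c i)) (d i)))).
      have NE : val n = \sum_i mc_RN (mc_g (val n) (c i)) (d i).
        rewrite -[LHS]n1 // (biadditive_sumr subS NSb) //; last by move=> i; apply: Sf.
        by apply: eq_bigr => i _; rewrite gf.
      have pure0 : pure (rd_set (mc_R C)) (@mc_MR C) (@mc_RN C) m (toN 0) = 0.
        apply: (addrI (pure _ _ _ m (toN 0))); rewrite addr0.
        by apply/esym/pure_addr; rewrite toNE ?addr0 //; apply: subgroup_set0.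
      transitivity (pure (rd_set (mc_R C)) (@mc_MR C) (@mc_RN C) m
          (toN (\sum_i mc_RN (mc_g (val n) (c i)) (d i)))).
        by rewrite -NE /toN valKd.
      elim: (index_enum _) => [|i r IHr]; first by rewrite !big_nil.
      rewrite !big_cons -IHr; apply: pure_addr; rewrite !toNE //.
      + by apply: subgroup_set_sum => // j _; apply: NRN => //; apply: Rg.
      + by apply: NRN => //; apply: Rg.
      + apply: subgroup_setD => //; first by apply: NRN => //; apply: Rg.
        by apply: subgroup_set_sum => // j _; apply: NRN => //; apply: Rg.
    apply: eq_bigr => i _; rewrite Fpure; apply/esym.
    apply: (pure_bal (r := mc_g (val n) (c i))); first exact: Rg.
      by rewrite toME; [apply: fg | apply/MSMc/Sf].
    by rewrite !toNE //; apply: NRN => //; apply: Rg.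
  - rewrite {1}uE {1}vE -sumrB; apply: eq_bigr => i _; rewrite raddfB.
    apply/eqP; rewrite subr_eq; apply/eqP/pure_addl.
    case: SMb => _ SMD _; rewrite !toME; try by [apply: MSMc|apply/MSMc/subgroup_setB].
      by rewrite -SMD ?subrK //; apply: subgroup_setB.
    by apply: (MSMc (F u - F v)); apply: subgroup_setB.
exists F; split=> //; split=> [u _|u v _ _ Fuv|s Ss]; first exact: S_F.
  by rewrite [u]uE [v]uE Fuv.
by eexists; [|exact: FE].
Qed.

End Morita.

(** * Inverses and translations in a groupoid *)

Section GroupoidTheory.

Variable G : groupoid.
Implicit Types g h k : G.

Lemma gcompKV g h : gtgt g = gtgt h -> gcomp g (gcomp (ginv g) h) = h.
Proof. by move=> gh; rewrite gcompA ?gsrc_inv ?gtgt_inv // gcompVr gh gcomp1l. Qed.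

Lemma gcompVK g h : gsrc g = gtgt h -> gcomp (ginv g) (gcomp g h) = h.
Proof. by move=> gh; rewrite gcompA ?gsrc_inv // gcompVl gh gcomp1l. Qed.

Lemma gcompK g h : gsrc g = gtgt h -> gcomp (gcomp g h) (ginv h) = g.
Proof. by move=> gh; rewrite -gcompA ?gtgt_inv // gcompVr -gh gcomp1r. Qed.

Lemma gcompKl g h : gsrc g = gsrc h -> gcomp (gcomp g (ginv h)) h = g.
Proof. by move=> gh; rewrite -gcompA ?gtgt_inv ?gsrc_inv // gcompVl -gh gcomp1r. Qed.

Lemma ginv_unique g h : gsrc g = gtgt h -> gcomp g h = gid (gtgt g) -> h = ginv g.
Proof.
move=> gh ghE; rewrite -(gcompVK gh) ghE.
by rewrite -[X in gid X]gsrc_inv gcomp1r.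
Qed.

Lemma ginvK g : ginv (ginv g) = g.
Proof. by apply/esym/ginv_unique; rewrite ?gsrc_inv // gcompVl gtgt_inv. Qed.

Lemma ginv_id (y : gobj G) : ginv (gid y) = gid y.
Proof.
apply/esym/ginv_unique; first by rewrite gsrc_id gtgt_id.
by rewrite -{2}(gsrc_id y) gcomp1r gtgt_id.
Qed.

Lemma ginv_comp g h : gsrc g = gtgt h -> ginv (gcomp g h) = gcomp (ginv h) (ginv g).
Proof.
move=> gh; have hg : gsrc (ginv h) = gtgt (ginv g) by rewrite gsrc_inv gtgt_inv.
apply/esym/ginv_unique; first by rewrite gsrc_comp // gtgt_comp // gtgt_inv.
by rewrite gcompA ?gsrc_comp ?gtgt_inv ?gsrc_inv //
  gcompK // gcompVr gtgt_comp.
Qed.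

(** Left translation by [g] is a bijection from the arrows with target s(g) onto those with target
    t(g), with inverse the translation by g^-1. *)
Lemma sum_gcompl (V : nmodType) g (F : G -> V) :
  \sum_(h | gsrc g == gtgt h) F (gcomp g h) = \sum_(k | gtgt g == gtgt k) F k.
Proof.
rewrite [RHS](reindex_onto (gcomp g) (gcomp (ginv g))) /=; last first.
  by move=> k /eqP gk; apply: gcompKV.
apply: eq_bigl => h; case: eqP => [gh|gh].
  by rewrite gtgt_comp // gcompVK // !eqxx.
apply/esym/negP => /andP[/eqP gk /eqP hE]; apply: gh.
by rewrite -hE gtgt_comp ?gtgt_inv ?gsrc_inv.
Qed.

Lemma sum_gcompr (V : nmodType) h (F : G -> V) :
  \sum_(g | gsrc g == gtgt h) F (gcomp g h) = \sum_(k | gsrc k == gsrc h) F k.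
Proof.
rewrite [RHS](reindex_onto (fun g => gcomp g h) (fun k => gcomp k (ginv h))) /=; last first.
  by move=> k /eqP kh; apply: gcompKl.
apply: eq_bigl => g; case: eqP => [gh|gh].
  by rewrite gsrc_comp // gcompK // !eqxx.
apply/esym/negP => /andP[/eqP gk /eqP gE]; apply: gh.
by rewrite -gE gsrc_comp ?gtgt_inv ?gsrc_inv.
Qed.

Lemma sum_ginv (V : nmodType) (F : G -> V) : \sum_g F (ginv g) = \sum_g F g.
Proof.
rewrite [RHS](reindex_onto (@ginv G) (@ginv G)) /=; last by move=> k _; apply: ginvK.
by apply: eq_bigl => g; rewrite ginvK eqxx.
Qed.

End GroupoidTheory.

(** * The calculus of the idempotents 1_g and the maps T_g *)

Section Twisted.

Variables (G : groupoid) (A : rngType).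

Definition pa_unit (th : paction G A) : A := \sum_(y : gobj G) pa_one th (gid y).

(* The calculus of a unital partial action on [pa_ring th = A 1], with [1] the  *)
(* sum of the [1_y], in terms of the idempotents [1_g] and of the globally      *)
(* defined multiplicative maps [a |-> theta_g (a 1_{g^-1})].                    *)
Record twisted (th : paction G A) : Prop := Twisted {
  tw_oneC : forall g a, a ** pa_one th g = pa_one th g ** a;
  tw_D : forall g a b, pa_twist th g (a + b) = pa_twist th g a + pa_twist th g b;
  tw_M : forall g a b, pa_twist th g (a ** b) = pa_twist th g a ** pa_twist th g b;
  tw_comp : forall g h a, gsrc g = gtgt h ->
    pa_twist th g (pa_twist th h a) = pa_twist th (gcomp g h) a ** pa_one th g;
  tw_mul1 : forall g a, pa_twist th g a ** pa_one th g = pa_twist th g a;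
  tw_1V : forall g, pa_twist th g (pa_one th (ginv g)) = pa_one th g;
  tw_1t : forall g, pa_one th g ** pa_one th (gid (gtgt g)) = pa_one th g;
  tw_id : forall y a, pa_twist th (gid y) a = a ** pa_one th (gid y);
  tw_orth : forall y z, y <> z -> pa_one th (gid y) ** pa_one th (gid z) = 0;
  tw_ring : forall a, pa_ring th a <-> a ** pa_unit th = a;
  tw_dom : forall g a, pa_dom th g a <-> a ** pa_one th g = a
}.

Variable th : paction G A.
Hypothesis tw : twisted th.

Local Notation one := (pa_one th).
Local Notation T := (pa_twist th).
Local Notation u := (pa_unit th).
Implicit Types (g h k : G) (a b c s : A).

Lemma one_idem g : one g ** one g = one g.
Proof. by rewrite -{1 3}(tw_1V tw g) tw_mul1. Qed.

Lemma unitC a : a ** u = u ** a.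
Proof.
by rewrite rngmul_sumr rngmul_suml; apply: eq_bigr => y _; rewrite tw_oneC.
Qed.

Lemma one_t g : one (gid (gtgt g)) ** one g = one g.
Proof. by rewrite -tw_oneC // tw_1t. Qed.

Lemma twist0 g : T g 0 = 0.
Proof. by apply: (addrI (T g 0)); rewrite -tw_D // !addr0. Qed.

Lemma twistN g a : T g (- a) = - T g a.
Proof. by apply/eqP; rewrite -addr_eq0 -tw_D // addNr twist0. Qed.

Lemma twist_sum g (I : Type) (r : seq I) (P : pred I) (F : I -> A) :
  T g (\sum_(i <- r | P i) F i) = \sum_(i <- r | P i) T g (F i).
Proof. by apply: (big_morph (T g)); [exact: tw_D | exact: twist0]. Qed.

Lemma twist_oneV g a : T g (a ** one (ginv g)) = T g a.
Proof. by rewrite tw_M // tw_1V // tw_mul1. Qed.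

Lemma one_mul_twist g a : one g ** T g a = T g a.
Proof. by rewrite -tw_oneC // tw_mul1. Qed.

Lemma twist_t g a : T g a ** one (gid (gtgt g)) = T g a.
Proof. by rewrite -[LHS]/(T g a ** _) -tw_mul1 // -rngmulA tw_1t // tw_mul1. Qed.

Lemma one_orth g h : gtgt g <> gtgt h -> one g ** one h = 0.
Proof.
move=> gh; rewrite -(tw_1t tw g) -(one_t h) rngmulA -(rngmulA (one g)).
by rewrite tw_orth // rngmul0r rngmul0l.
Qed.

Lemma mul_orth g h a b : a ** one g = a -> b ** one h = b -> gtgt g <> gtgt h -> a ** b = 0.
Proof.
move=> <- <- gh; rewrite -rngmulA (rngmulA (one g)) -tw_oneC // -!rngmulA.
by rewrite one_orth // !rngmul0r.
Qed.

Lemma twist_mul_orth g h a b : gtgt g <> gtgt h -> T g a ** T h b = 0.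
Proof. by apply: mul_orth; apply: tw_mul1. Qed.

Lemma twist_orth g a : a ** one (ginv g) = 0 -> T g a = 0.
Proof. by rewrite -twist_oneV => ->; apply: twist0. Qed.

(** T_h a lies in A 1_{t(h)}, whereas T_g only sees the component in A 1_{s(g)}; these are
    orthogonal. *)
Lemma twist_comp_orth g h a : gsrc g <> gtgt h -> T g (T h a) = 0.
Proof.
move=> gh; apply: twist_orth; rewrite -(tw_mul1 tw) -rngmulA one_orth ?rngmul0r //.
by rewrite gtgt_inv => hg; apply: gh.
Qed.

Lemma one_mul_unit g : one g ** u = one g.
Proof.
rewrite rngmul_sumr (bigD1 (gtgt g)) //= tw_1t // big1 ?addr0 // => y /eqP yg.
by rewrite one_orth // gtgt_id => gy; apply: yg.
Qed.

Lemma twist_mul_unit g a : T g a ** u = T g a.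
Proof. by rewrite -(tw_mul1 tw) -rngmulA one_mul_unit. Qed.

Lemma unit_idem : u ** u = u.
Proof. by rewrite {1}/pa_unit rngmul_suml; apply: eq_bigr => y _; apply: one_mul_unit. Qed.

Lemma twist_mul_unitr g a : T g (a ** u) = T g a.
Proof. by rewrite -twist_oneV -rngmulA -unitC one_mul_unit twist_oneV. Qed.

Lemma twist_unit g : T g u = one g.
Proof. by rewrite -twist_oneV -unitC one_mul_unit tw_1V. Qed.

Lemma twist_one g h : gsrc g = gtgt h -> T g (one h) = one (gcomp g h) ** one g.
Proof. by move=> gh; rewrite -twist_unit tw_comp // twist_unit. Qed.

Lemma twistK g a : T (ginv g) (T g a) = a ** one (ginv g).
Proof.
rewrite tw_comp ?gsrc_inv // gcompVl tw_id // -rngmulA; congr (_ ** _).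
by rewrite -[gsrc g]gtgt_inv one_t.
Qed.

Lemma pa_funE g a : a ** one (ginv g) = a -> pa_fun th g a = T g a.
Proof. by rewrite /pa_twist => ->. Qed.

End Twisted.

(** * The skew groupoid ring and its Morita context *)

Section GaloisContext.

Variables (G : groupoid) (A : rngType) (th : paction G A).
Hypothesis tw : twisted th.

Local Notation one := (pa_one th).
Local Notation T := (pa_twist th).
Local Notation u := (pa_unit th).
Local Notation t := (pa_trace th).
Implicit Types (g h k : G) (a b c s : A) (f : {ffun G -> A}).

Lemma twist_mul_one g a b : T g a ** (b ** one g) = T g a ** b.
Proof. by rewrite (tw_oneC tw) rngmulA (tw_mul1 tw). Qed.

Lemma skewP f : skew th f <-> forall g, f g ** one g = f g.
Proof. by split=> fS g; apply/(tw_dom tw). Qed.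

Lemma subgroup_ring : subgroup_set (pa_ring th).
Proof.
split=> [|a b /(tw_ring tw) aE /(tw_ring tw) bE]; apply/(tw_ring tw).
  exact: rngmul0l.
by rewrite rngmulBl aE bE.
Qed.

Lemma ring_mull a b : pa_ring th b -> pa_ring th (a ** b).
Proof. by move/(tw_ring tw) => bE; apply/(tw_ring tw); rewrite -rngmulA bE. Qed.

Lemma ring_mulr a b : pa_ring th a -> pa_ring th (a ** b).
Proof.
by move/(tw_ring tw) => aE; apply/(tw_ring tw); rewrite -rngmulA unitC // rngmulA aE.
Qed.

Lemma ring_twist g a : pa_ring th (T g a).
Proof. by apply/(tw_ring tw); apply: twist_mul_unit. Qed.

Lemma subgroup_invariants : subgroup_set (pa_invariants th).
Proof.
split=> [|a b [aP aT] [bP bT]]; split.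
- exact: (subgroup_set0 subgroup_ring).
- by move=> g; rewrite -/(T g 0) twist0 // rngmul0l.
- exact: (subgroup_setB subgroup_ring).
- by move=> g; rewrite (tw_D tw) twistN // aT bT rngmulBl.
Qed.

Lemma invariants_mul a b :
  pa_invariants th a -> pa_invariants th b -> pa_invariants th (a ** b).
Proof.
move=> [aP aT] [bP bT]; split=> [|g]; first exact: ring_mull.
by rewrite (tw_M tw) aT -rngmulA one_mul_twist // bT rngmulA.
Qed.

Lemma biadditive_mul (X Y Z : set A) :
  (forall a b, X a -> Y b -> Z (a ** b)) -> biadditive_on X Y Z (@rngmul A).
Proof. by split=> // *; rewrite ?rngmulDl ?rngmulDr. Qed.

Lemma twist_invl g s a : pa_invariants th s -> T g (s ** a) = s ** T g a.
Proof. by case=> _ sT; rewrite (tw_M tw) sT -rngmulA one_mul_twist. Qed.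

Lemma twist_invr g s a : pa_invariants th s -> T g (a ** s) = T g a ** s.
Proof. by case=> _ sT; rewrite (tw_M tw) sT twist_mul_one. Qed.

Lemma is_rng_invariants : is_rng (RngData (pa_invariants th) (@rngmul A)).
Proof.
split=> [||a b c _ _ _] /=; [exact: subgroup_invariants | | by rewrite rngmulA].
exact/biadditive_mul/invariants_mul.
Qed.

Lemma subgroup_skew : subgroup_set (skew th).
Proof.
split=> [|f f' /skewP fS /skewP fS']; apply/skewP => g; rewrite !ffunE.
  exact: rngmul0l.
by rewrite rngmulBl fS fS'.
Qed.

(** In a factorization k = gh the factor h is determined by g, so the double sum reduces to one over
    the g with the target of [k]. *)
Lemma skew_mulE f f' k :
  skew_mul th f f' k =
  \sum_(g | gtgt g == gtgt k) f g ** T g (f' (gcomp (ginv g) k)).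
Proof.
rewrite ffunE [RHS]big_mkcond; apply: eq_bigr => g _; case: eqP => [gk|gk].
  rewrite (big_pred1 (gcomp (ginv g) k)) // => h; apply/andP/eqP => [[/eqP gh /eqP <-]|->].
    by rewrite gcompVK.
  by rewrite gtgt_comp ?gsrc_inv // gtgt_inv gcompKV // !eqxx.
by rewrite big_pred0 // => h; apply/andP => -[/eqP gh /eqP hk]; apply: gk; rewrite -hk gtgt_comp.
Qed.

(** Both module actions have the form of a sum of additive functions of the coefficients; this
    evaluates such a sum on a product as a sum over composable pairs. *)
Lemma sum_skew_mul (W : nmodType) (phi : G -> A -> W) f f' :
  (forall k, phi k 0 = 0) -> (forall k, {morph phi k : a b / a + b}) ->
  \sum_k phi k (skew_mul th f f' k) =
  \sum_g \sum_(h | gsrc g == gtgt h) phi (gcomp g h) (f g ** T g (f' h)).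
Proof.
move=> phi0 phiD.
under eq_bigr => k _.
  rewrite ffunE (big_morph _ (phiD k) (phi0 k)).
  under eq_bigr do rewrite (big_morph _ (phiD k) (phi0 k)).
  over.
rewrite exchange_big; apply: eq_bigr => g _ /=.
rewrite (exchange_big_dep (fun h => gsrc g == gtgt h)) /=; last first.
  by move=> k h _ /andP[].
apply: eq_bigr => h gh; rewrite (big_pred1 (gcomp g h)) // => k.
by rewrite gh eq_sym.
Qed.

Lemma skew_mul_skew f f' : skew th f' -> skew th (skew_mul th f f').
Proof.
move=> /skewP fS'; apply/skewP => k; rewrite skew_mulE rngmul_suml.
apply: eq_bigr => g /eqP gk; set h := gcomp _ _.
have gh : gsrc g = gtgt h by rewrite gtgt_comp ?gsrc_inv // gtgt_inv.
(* Since f'_h = f'_h 1_h and T_g(1_h) = 1_{gh} 1_g with gh = k. *)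
have -> : T g (f' h) = T g (f' h) ** one k.
  by rewrite -{1}fS' (tw_M tw) twist_one // gcompKV // twist_mul_one.
by rewrite -!rngmulA one_idem.
Qed.

Lemma skew_mulDl f f' f'' :
  skew_mul th (f + f') f'' = skew_mul th f f'' + skew_mul th f' f''.
Proof.
apply/ffunP => k; rewrite [RHS]ffunE !skew_mulE -big_split; apply: eq_bigr => g _.
by rewrite ffunE rngmulDl.
Qed.

Lemma skew_mulDr f f' f'' :
  skew_mul th f (f' + f'') = skew_mul th f f' + skew_mul th f f''.
Proof.
apply/ffunP => k; rewrite [RHS]ffunE !skew_mulE -big_split; apply: eq_bigr => g _.
by rewrite ffunE (tw_D tw) rngmulDr.
Qed.

Lemma skew_mulA f f' f'' :
  skew_mul th f (skew_mul th f' f'') = skew_mul th (skew_mul th f f') f''.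
Proof.
apply/ffunP => k; rewrite !skew_mulE.
transitivity (\sum_(g | gtgt g == gtgt k) \sum_(m | gtgt g == gtgt m)
    f g ** T g (f' (gcomp (ginv g) m)) ** T m (f'' (gcomp (ginv m) k))).
  apply: eq_bigr => g /eqP gk.
  rewrite skew_mulE twist_sum // rngmul_sumr gtgt_comp ?gsrc_inv // gtgt_inv -sum_gcompl.
  apply: eq_big => [h|h /eqP gh]; first by rewrite eq_sym.
  rewrite (tw_M tw) (tw_comp tw) // twist_mul_one // rngmulA gcompVK //.
  by rewrite ginv_comp // -gcompA ?gsrc_inv ?gtgt_inv.
rewrite (exchange_big_dep (fun m => gtgt m == gtgt k)) /=; last first.
  by move=> g m /eqP <- /eqP <-.
apply: eq_bigr => m /eqP mk; rewrite skew_mulE rngmul_suml mk.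
by apply: eq_bigl => g; rewrite andbb.
Qed.

Lemma is_rng_skew : is_rng (RngData (skew th) (skew_mul th)).
Proof.
split=> /= [||f f' f'' _ _ _]; [exact: subgroup_skew | | exact: skew_mulA].
split=> *; [exact: skew_mul_skew | exact: skew_mulDl | exact: skew_mulDr].
Qed.

Lemma skew_actrE b f : skew th f ->
  skew_actr th b f = \sum_g T (ginv g) (b ** f g).
Proof.
move=> /skewP fS; apply: eq_bigr => g _; apply: pa_funE.
by rewrite ginvK -rngmulA fS.
Qed.

Lemma skew_actl_ring f b : skew th f -> pa_ring th (skew_actl th f b).
Proof.
by move=> fS; apply: (subgroup_set_sum subgroup_ring) => g _; apply/ring_mull/ring_twist.
Qed.

Lemma skew_actr_ring b f : skew th f -> pa_ring th (skew_actr th b f).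
Proof.
move=> fS; rewrite skew_actrE //.
by apply: (subgroup_set_sum subgroup_ring) => g _; apply: ring_twist.
Qed.

Lemma skew_actlM f f' b : skew_actl th (skew_mul th f f') b = skew_actl th f (skew_actl th f' b).
Proof.
rewrite /skew_actl (sum_skew_mul (phi := fun k a => a ** T k b)); last first.
- by move=> k a a'; rewrite rngmulDl.
- by move=> k; rewrite rngmul0l.
apply: eq_bigr => g _; rewrite twist_sum // rngmul_sumr [RHS](bigID (fun h => gsrc g == gtgt h)) /=.
rewrite [X in _ = _ + X]big1 ?addr0 => [|h /eqP gh].
  by apply: eq_bigr => h /eqP gh; rewrite (tw_M tw) (tw_comp tw) // twist_mul_one // rngmulA.
by rewrite (tw_M tw) twist_comp_orth // !rngmul0r.
Qed.

Lemma skew_actrM b f f' : skew th f -> skew th f' ->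
  skew_actr th b (skew_mul th f f') = skew_actr th (skew_actr th b f) f'.
Proof.
move=> fS fS'; rewrite !skew_actrE //; last exact: skew_mul_skew.
rewrite (sum_skew_mul (phi := fun k a => T (ginv k) (b ** a))); last first.
- by move=> k a a'; rewrite rngmulDr (tw_D tw).
- by move=> k; rewrite rngmul0r twist0.
under [RHS]eq_bigr => h _ do rewrite rngmul_suml twist_sum //.
rewrite exchange_big; apply: eq_bigr => g _ /=.
rewrite [RHS](bigID (fun h => gsrc g == gtgt h)) /=.
rewrite [X in _ = _ + X]big1 ?addr0 => [|h /eqP gh]; last first.
  by rewrite (tw_M tw) twist_comp_orth ?rngmul0l // gsrc_inv gtgt_inv => hg; apply: gh.
apply: eq_bigr => h /eqP gh; rewrite rngmulA !(tw_M tw _ _ (T _ _)) (tw_M tw _ _ (f' h)).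
have hg : gsrc (ginv h) = gtgt (ginv g) by rewrite gsrc_inv gtgt_inv.
rewrite (tw_comp tw _ hg) -ginv_comp // (tw_comp tw); last first.
  by rewrite gsrc_inv gtgt_comp.
rewrite twist_mul_one // [X in T X (f' h)](_ : _ = ginv h); last first.
  by rewrite ginv_comp // gcompKl ?gsrc_inv.
by rewrite -[in RHS]rngmulA one_mul_twist.
Qed.

(** Only arrows k with s(k) = t(g) contribute on the left, and k |-> kg carries them onto the arrows
    with source s(g), the only ones that contribute on the right. *)
Lemma trace_twist g a : t (T g a) = t (a ** one (ginv g)).
Proof.
rewrite /pa_trace (bigID (fun k => gsrc k == gtgt g)) /= [X in _ + X]big1 ?addr0; last first.
  by move=> k /eqP; apply: twist_comp_orth.
rewrite [RHS](bigID (fun k => gsrc k == gsrc g)) /= [X in _ = _ + X]big1 ?addr0; last first.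
  move=> k /eqP kg; rewrite -twist_oneV // -rngmulA one_orth ?rngmul0r ?twist0 //.
  by rewrite !gtgt_inv => gk; apply: kg.
rewrite -sum_gcompr; apply: eq_bigr => k /eqP kg.
rewrite (tw_comp tw) // (tw_M tw) twist_one //; last first.
  by rewrite gsrc_comp // gtgt_inv.
by rewrite gcompK // twist_mul_one.
Qed.

Lemma trace_sum (I : Type) (r : seq I) (P : pred I) (F : I -> A) :
  t (\sum_(i <- r | P i) F i) = \sum_(i <- r | P i) t (F i).
Proof.
by rewrite /pa_trace; under eq_bigr do rewrite twist_sum //; rewrite exchange_big.
Qed.

Lemma traceD a b : t (a + b) = t a + t b.
Proof. by rewrite /pa_trace -big_split; apply: eq_bigr => g _; rewrite (tw_D tw). Qed.

(** Applying T_g permutes the summands with target s(g) onto those with target t(g) by left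
    translation, at the cost of a factor 1_g; all other summands vanish on both sides. *)
Lemma trace_invariant a : pa_invariants th (t a).
Proof.
split=> [|g].
  by apply: (subgroup_set_sum subgroup_ring) => g _; apply: ring_twist.
rewrite /pa_trace twist_sum // (bigID (fun h => gsrc g == gtgt h)) /=.
rewrite [X in _ + X]big1 ?addr0; last by move=> h /eqP; apply: twist_comp_orth.
rewrite rngmul_suml [RHS](bigID (fun h => gtgt g == gtgt h)) /=.
rewrite [X in _ = _ + X]big1 ?addr0 => [|h /eqP gh]; last first.
  by rewrite -(tw_mul1 tw h) -rngmulA one_orth ?rngmul0r // => hg; apply: gh.
rewrite -(sum_gcompl g (fun h => T h a ** one g)).
by apply: eq_bigr => h /eqP gh; rewrite (tw_comp tw).
Qed.

(** Term by term, T_{g^-1}(a f_g) b = T_{g^-1}(a f_g T_g(b)), and [trace_twist] removes the outer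
    T_{g^-1} because f_g 1_g = f_g. *)
Lemma Gam_bal a f b : skew th f -> Gam th (skew_actr th a f) b = Gam th a (skew_actl th f b).
Proof.
move=> fS; rewrite /Gam skew_actrE // rngmul_suml rngmul_sumr !trace_sum.
apply: eq_bigr => g _.
have -> : T (ginv g) (a ** f g) ** b = T (ginv g) (a ** f g ** T g b).
  by rewrite (tw_M tw _ _ (T g b)) twistK // twist_mul_one.
by rewrite trace_twist ginvK -rngmulA (tw_mul1 tw) rngmulA.
Qed.

Lemma Gam'_skew a b : skew th (Gam' th a b).
Proof. by apply/skewP => g; rewrite ffunE -rngmulA (tw_mul1 tw). Qed.

Lemma Gam'_mull f a b : skew th f -> Gam' th (skew_actl th f a) b = skew_mul th f (Gam' th a b).
Proof.
move=> /skewP fS; apply/ffunP => k; rewrite skew_mulE ffunE rngmul_suml.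
rewrite (bigID (fun g => gtgt g == gtgt k)) /= [X in _ + X]big1 ?addr0 => [|g /eqP gk].
  apply: eq_bigr => g /eqP gk; rewrite ffunE (tw_M tw) (tw_comp tw); last first.
    by rewrite gtgt_comp ?gsrc_inv // gtgt_inv.
  by rewrite gcompKV // twist_mul_one // rngmulA.
by rewrite -rngmulA twist_mul_orth // rngmul0r.
Qed.

Lemma Gam'_mulr a b f : skew th f -> Gam' th a (skew_actr th b f) = skew_mul th (Gam' th a b) f.
Proof.
move=> fS; have /skewP fS' := fS; apply/ffunP => k; rewrite !ffunE skew_actrE //.
rewrite twist_sum // rngmul_sumr.
rewrite (bigID (fun h => gsrc h == gsrc k)) /= [X in _ + X]big1 ?addr0; last first.
  move=> h /eqP hk; rewrite twist_comp_orth ?rngmul0r // gtgt_inv => kh; exact: hk.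
under [RHS]eq_bigr => g _ do rewrite ffunE.
rewrite [RHS](exchange_big_dep (fun h => gsrc h == gsrc k)) /=; last first.
  by move=> g h _ /andP[/eqP gh /eqP <-]; rewrite gsrc_comp.
apply: eq_bigr => h /eqP hk; rewrite (big_pred1 (gcomp k (ginv h))); last first.
  move=> g; apply/andP/eqP => [[/eqP gh /eqP <-]|->]; first by rewrite gcompK.
  by rewrite gsrc_comp ?gsrc_inv ?gtgt_inv // gcompKl // !eqxx.
rewrite (tw_comp tw) ?gtgt_inv // (tw_M tw).
have fhE : T (gcomp k (ginv h)) (f h) = T (gcomp k (ginv h)) (f h) ** one k.
  rewrite -[f h in LHS]fS' (tw_M tw) twist_one //; last by rewrite gsrc_comp ?gsrc_inv ?gtgt_inv.
  by rewrite gcompKl // twist_mul_one.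
by rewrite -(rngmulA (T _ b)) -fhE rngmulA.
Qed.

Lemma is_morita_context_galois : is_morita_context (galois_context th).
Proof.
split=> /=.
- by split; [exact: is_rng_invariants | exact: is_rng_skew].
- split; split=> /=.
  + exact: subgroup_ring.
  + split; first by apply: biadditive_mul => a b _; apply: ring_mull.
    split=> [a f _|a b f _ _ fS|a f f' _ fS fS']; first exact: skew_actr_ring.
      rewrite !skew_actrE // -big_split; apply: eq_bigr => g _.
      by rewrite rngmulDl (tw_D tw).
    rewrite !skew_actrE //; last exact: (subgroup_setD subgroup_skew).
    by rewrite -big_split; apply: eq_bigr => g _; rewrite ffunE rngmulDr (tw_D tw).
  + by move=> s s' m _ _ _; rewrite rngmulA.
  + by move=> m r r' _; apply: skew_actrM.
  + move=> s m r sS _ rS; rewrite !skew_actrE // rngmul_sumr.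
    by apply: eq_bigr => g _; rewrite -rngmulA twist_invl.
  + exact: subgroup_ring.
  + split; last by apply: biadditive_mul => a b aP _; apply: ring_mulr.
    split=> [f a fS _|f f' a _ _ _|f a b _ _ _]; first exact: skew_actl_ring.
      by rewrite /skew_actl -big_split; apply: eq_bigr => g _; rewrite ffunE rngmulDl.
    by rewrite /skew_actl -big_split; apply: eq_bigr => g _; rewrite (tw_D tw) rngmulDr.
  + by move=> s s' m _ _ _; apply: skew_actlM.
  + by move=> m r r' _ _ _; rewrite rngmulA.
  + move=> f m s _ _ sS; rewrite /skew_actl rngmul_suml.
    by apply: eq_bigr => g _; rewrite twist_invr // rngmulA.
- split; split=> /=.
  + split=> [a b _ _|a b c _ _ _|a b c _ _ _]; first exact: trace_invariant.
      by rewrite /Gam rngmulDl traceD.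
    by rewrite /Gam rngmulDr traceD.
  + by move=> a f b _ fS _; apply: Gam_bal.
  + move=> s a b sS _ _; rewrite /Gam /pa_trace rngmul_sumr.
    by apply: eq_bigr => g _; rewrite -rngmulA twist_invl.
  + move=> a b s _ _ sS; rewrite /Gam /pa_trace rngmul_suml.
    by apply: eq_bigr => g _; rewrite rngmulA twist_invr.
  + split=> [a b _ _|a b c _ _ _|a b c _ _ _]; first exact: Gam'_skew.
      by apply/ffunP => g; rewrite !ffunE rngmulDl.
    by apply/ffunP => g; rewrite !ffunE (tw_D tw) rngmulDr.
  + by move=> a s b _ sS _; apply/ffunP => g; rewrite !ffunE twist_invl // rngmulA.
  + by move=> f a b fS _ _; apply: Gam'_mull.
  + by move=> a b f _ _; apply: Gam'_mulr.
- move=> a b c _ _ _; rewrite skew_actrE; last exact: Gam'_skew.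
  rewrite /Gam /pa_trace rngmul_suml -sum_ginv; apply: eq_bigr => g _.
  by rewrite ffunE rngmulA (tw_M tw _ _ (T g c)) twistK // twist_mul_one.
- move=> a b c _ _ _; rewrite /skew_actl /Gam /pa_trace rngmul_sumr.
  by apply: eq_bigr => g _; rewrite ffunE (tw_M tw) rngmulA.
Qed.

End GaloisContext.

(** * Strictness as Galois coordinates plus a surjective trace *)

Section Strictness.

Variables (G : groupoid) (A : rngType) (th : paction G A).
Hypothesis tw : twisted th.

Local Notation one := (pa_one th).
Local Notation T := (pa_twist th).
Local Notation u := (pa_unit th).
Local Notation t := (pa_trace th).
Implicit Types (g h k : G) (a b c s : A) (f : {ffun G -> A}).

Lemma sum_gid (V : nmodType) (F : G -> V) :
  (forall g, g <> gid (gsrc g) -> F g = 0) -> \sum_g F g = \sum_y F (gid y).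
Proof.
move=> F0; rewrite (bigID (fun g => g == gid (gsrc g))) /=.
rewrite [X in _ + X]big1 ?addr0 => [|g /eqP]; last exact: F0.
rewrite (reindex_onto (@gid G) (@gsrc G)) /=; last by move=> g /eqP.
by apply: eq_bigl => y; rewrite gsrc_id !eqxx.
Qed.

(** The identity sum_y 1_y delta_y of the skew ring. Its coefficients are exactly the right-hand
    sides of the Galois equations, so coordinates amount to an expression of it as a sum of values
    of Gamma'. *)
Definition skew_one : {ffun G -> A} :=
  [ffun g => if g == gid (gsrc g) then one g else 0].

Lemma skew_one_skew : skew th skew_one.
Proof.
apply/(skewP tw) => g; rewrite ffunE; case: ifP => _; first exact: one_idem.
exact: rngmul0l.
Qed.

Lemma skew_mul1r f : skew th f -> skew_mul th f skew_one = f.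
Proof.
move=> /(skewP tw) fS; apply/ffunP => k; rewrite skew_mulE (bigD1 k) //=.
rewrite big1 ?addr0 => [|g /andP[/eqP gk /eqP g_k]]; rewrite ffunE.
  by rewrite gcompVl gsrc_id eqxx twist_one ?gtgt_id // gcomp1r one_idem.
case: eqP => [gE|_]; last by rewrite twist0 // rngmul0r.
have sE : gsrc (gcomp (ginv g) k) = gsrc g.
  by rewrite -[LHS]gtgt_id -gE gtgt_comp ?gsrc_inv // gtgt_inv.
by case: g_k; rewrite -[RHS](gcompKV gk) gE sE gcomp1r.
Qed.

Lemma skew_actr1 a : pa_ring th a -> skew_actr th a skew_one = a.
Proof.
move=> /(tw_ring tw) aE; rewrite skew_actrE //; last exact: skew_one_skew.
rewrite sum_gid => [|g /eqP/negPf gE]; last first.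
  by rewrite ffunE gE rngmul0r twist0.
rewrite -[RHS]aE rngmul_sumr; apply: eq_bigr => y _.
by rewrite ffunE gsrc_id eqxx ginv_id (tw_id tw) -rngmulA one_idem.
Qed.

Lemma galois_skew_one : pa_galois th ->
  exists r (a b : 'I_r -> A),
    [/\ forall i, pa_ring th (a i), forall i, pa_ring th (b i)
      & forall g, \sum_i a i ** T g (b i) = skew_one g].
Proof.
case=> r [_ [a [b [aP bP ab1 ab0]]]]; exists r, a, b; split=> // g; rewrite ffunE.
case: eqP => [->|gE]; first by rewrite ab1.
by rewrite ab0 // => y gy; apply: gE; rewrite gy gsrc_id.
Qed.

Lemma skew_one_galois (I : finType) (a b : I -> A) :
  (forall i, pa_ring th (a i)) -> (forall i, pa_ring th (b i)) ->
  (forall g, \sum_i a i ** T g (b i) = skew_one g) -> pa_galois th.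
Proof.
move=> aP bP abE; pose n := #|I|.
(* A zero term is put in front so that the number of coordinates is at least 1 even when [I] is
   empty. *)
pose ext (c : I -> A) (i : 'I_n.+1) : A :=
  if unlift ord0 i is Some j then c (enum_val j) else 0.
have extP (c : I -> A) : (forall i, pa_ring th (c i)) -> forall i, pa_ring th (ext c i).
  move=> cP i; rewrite /ext; case: unliftP => // _.
  exact: (subgroup_set0 (subgroup_ring tw)).
have sumE g : \sum_i ext a i ** T g (ext b i) = skew_one g.
  rewrite big_ord_recl {1}/ext unlift_none rngmul0l add0r -abE.
  rewrite [RHS](eq_bigl [in I]) // [RHS]big_enum_val.
  by apply: eq_bigr => i _; rewrite /ext liftK.
exists n.+1; split=> //; exists (ext a), (ext b).
split=> [||y|g gE]; try exact: extP.
  by rewrite sumE ffunE gsrc_id eqxx.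
by rewrite sumE ffunE; case: eqP => // /gE.
Qed.

Lemma unit_invariant : pa_invariants th u.
Proof.
split=> [|g]; first by apply/(tw_ring tw); apply: unit_idem.
by rewrite -unitC // one_mul_unit // -/(T g u) twist_unit.
Qed.

(** A preimage of [skew_one] under Gamma' is a system of coordinates; a preimage sum_i a_i (x) b_i
    of an invariant under Gamma gives the element sum_i a_i b_i having it as trace. *)
Lemma strict_galois : strict_morita_context (galois_context th) ->
  pa_galois th /\ pa_trace_onto th.
Proof.
have subP := subgroup_ring tw.
case=> -[_ _ [[/= Gb _ _ _] [/= G'b _ _ _]] _ _] /= bijG bijG'; split.
  have [r [a [b [aP bP abE]]]] := tensor_bij_sum subP subP G'b bijG' skew_one_skew.
  apply: (skew_one_galois aP bP) => g.
  by rewrite abE sum_ffunE; apply: eq_bigr => i _; rewrite ffunE.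
move=> s /(tensor_bij_sum subP subP Gb bijG)[r [a [b [aP bP ->]]]].
exists (\sum_i a i ** b i); last by rewrite trace_sum.
by apply: subgroup_set_sum => // i _; apply: ring_mull.
Qed.

Lemma galois_strict : pa_galois th -> pa_trace_onto th ->
  strict_morita_context (galois_context th).
Proof.
move=> /galois_skew_one[r [a [b [aP bP abgE]]]] onto_t.
have abE : skew_one = \sum_i Gam' th (a i) (b i).
  apply/ffunP => g; rewrite sum_ffunE -abgE.
  by apply: eq_bigr => i _; rewrite ffunE.
have mc := is_morita_context_galois tw.
have uP := (unit_invariant).1.
have [c cP cE] := onto_t u unit_invariant.
split=> //.
  (* One pair suffices for Gamma: if t(c) = 1 then Gamma(c (x) 1) = t(c) = 1. *)
  have cuE : \sum_(i < 1) Gam th c u = u.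
    by rewrite big_ord1 /Gam; move/(tw_ring tw): cP => ->.
  apply: (@morita_tensor_bij (galois_context th) 'I_1 (fun=> c) (fun=> u)) => //= s.
    by move/(tw_ring tw); rewrite cuE.
  by case=> /(tw_ring tw) + _; rewrite cuE.
apply: (@morita_tensor_bij (morita_swap (galois_context th)) _ a b) => //=.
- exact: (is_morita_context_swap mc).
- by move=> n nP; rewrite -abE; apply: skew_actr1.
- by move=> s sS; rewrite -abE; apply: skew_mul1r.
Qed.

End Strictness.

(** * Passage between theta and its restriction to the isotropy group *)

Section IsotropyRestriction.

Variables (G : groupoid) (x : gobj G) (tr : gtransversal x).
Variables (A : rngType) (th : paction G A).
Hypothesis tw : twisted th.

Local Notation thx := (isotropy_restr x th).
Local Notation one := (pa_one th).
Local Notation T := (pa_twist th).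
Local Notation u := (pa_unit th).
Local Notation t := (pa_trace th).
Local Notation tx := (pa_trace thx).
Implicit Types (g h k : G) (a b c s : A) (l : isotropy x).

(** In terms of idempotents, the next two assumptions say that theta_{tau_y} maps the whole of B_x
    onto the whole of B_y. *)
Hypothesis tau_one : forall y, one (tr y) = one (gid y).
Hypothesis tauV_one : forall y, one (ginv (tr y)) = one (gid x).

Lemma pa_oneEx l : pa_one thx l = one (val l). Proof. by []. Qed.

Lemma pa_twistEx l a : pa_twist thx l a = T (val l) a. Proof. by []. Qed.

Lemma pa_unitEx : pa_unit thx = one (gid x).
Proof. exact: (big_pred1 tt). Qed.

Lemma gsrc_loop l : gsrc (val l) = x.
Proof. by case: l => g /= /andP[/eqP]. Qed.

Lemma gtgt_loop l : gtgt (val l) = x.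
Proof. by case: l => g /= /andP[_ /eqP]. Qed.

Lemma twisted_restr : twisted thx.
Proof.
split.
- by move=> l a; apply: (tw_oneC tw).
- by move=> l a b; apply: (tw_D tw).
- by move=> l a b; apply: (tw_M tw).
- by move=> l l' a _; apply: (tw_comp tw); rewrite gsrc_loop gtgt_loop.
- by move=> l a; apply: (tw_mul1 tw).
- by move=> l; apply: (tw_1V tw).
- move=> l; have := tw_1t tw (val l); rewrite gtgt_loop; exact.
- by move=> y a; apply: (tw_id tw).
- by move=> [] [].
- by move=> a; rewrite pa_unitEx; apply: (tw_dom tw).
- by move=> l a; apply: (tw_dom tw).
Qed.

Lemma twist_one_s g a : T g (a ** one (gid (gsrc g))) = T g a.
Proof.
by rewrite (tw_M tw) twist_one ?gtgt_id // gcomp1r one_idem // (tw_mul1 tw).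
Qed.

Lemma twist_one_at y g a : gsrc g = y -> T g (a ** one (gid y)) = T g a.
Proof. by move=> <-; apply: twist_one_s. Qed.

Lemma twist_t_at y g a : gtgt g = y -> T g a ** one (gid y) = T g a.
Proof. by move=> <-; apply: twist_t. Qed.

Lemma gcomp1r_at y g : gsrc g = y -> gcomp g (gid y) = g.
Proof. by move=> <-; apply: gcomp1r. Qed.

(** When theta_k is defined on all of B_{s(k)}, the factor 1_g of the composition rule disappears:
    composing gk with k^-1 shows that T_{gk} a = T_g(T_k a) 1_{gk}, which already carries a factor
    1_g. *)
Lemma twist_comp_eqV g k a : one (ginv k) = one (gid (gsrc k)) ->
  gsrc g = gtgt k -> T g (T k a) = T (gcomp g k) a.
Proof.
move=> kE gk; have X := tw_comp tw a gk.
have Y : T (gcomp g k) a = T g (T k a) ** one (gcomp g k).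
  have := tw_comp tw (T k a) (g := gcomp g k) (h := ginv k).
  rewrite twistK // gcompK // kE -[in gid _](gsrc_comp gk) twist_one_s; apply.
  by rewrite gsrc_comp // gtgt_inv.
by rewrite Y [in RHS]X -rngmulA -(tw_oneC tw g) rngmulA (tw_mul1 tw) -X.
Qed.

Lemma twist_comp_eq k h a : one k = one (gid (gtgt k)) ->
  gsrc k = gtgt h -> T k (T h a) = T (gcomp k h) a.
Proof. by move=> kE kh; rewrite (tw_comp tw) // kE -(gtgt_comp kh) twist_t. Qed.

Lemma twist_tau g b : T g (T (tr (gsrc g)) b) = T (gcomp g (tr (gsrc g))) b.
Proof. by rewrite twist_comp_eqV // ?gtgt_tau // gsrc_tau. Qed.

Lemma tau_twist g b : gtgt g = x -> forall y, T (tr y) (T g b) = T (gcomp (tr y) g) b.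
Proof. by move=> gx y; rewrite twist_comp_eq ?gtgt_tau // gsrc_tau. Qed.

Lemma tau_loop_conj g : gcomp (tr (gtgt g)) (val (loop_conj tr g)) = gcomp g (tr (gsrc g)).
Proof. by rewrite /= gcompKV // gtgt_comp ?gtgt_tau. Qed.

(** Both sides equal T applied along g tau_{s(g)} = tau_{t(g)} g_x. This reduces the action of an
    arbitrary arrow to that of a loop at [x]. *)
Lemma twist_tau_loop g b :
  T g (T (tr (gsrc g)) b) = T (tr (gtgt g)) (pa_twist thx (loop_conj tr g) b).
Proof. by rewrite twist_tau -tau_loop_conj -tau_twist // gtgt_loop. Qed.

Lemma loop_conj_id g : gsrc g = gtgt g ->
  (loop_conj tr g == loop_id x) = (g == gid (gsrc g)).
Proof.
move=> gg; have tauE y : gcomp (tr y) (gid x) = tr y.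
  by rewrite gcomp1r_at ?gsrc_tau.
apply/eqP/eqP => [/(congr1 val) gE|gE].
  have := tau_loop_conj g; rewrite gE /= tauE -gg => trE.
  rewrite -[LHS](gcompK (h := tr (gsrc g))) ?gtgt_tau // -trE gcompVr.
  by rewrite gtgt_tau.
apply/val_inj => /=; have -> : gcomp g (tr (gsrc g)) = tr (gsrc g).
  by rewrite gE gsrc_id -[X in gid X](gtgt_tau tr (gsrc g)) gcomp1l.
by rewrite -gg gcompVl gsrc_tau.
Qed.

Lemma twist_tau_orth y g b : gsrc g <> y -> T g (T (tr y) b) = 0.
Proof. by move=> gy; apply: twist_comp_orth => //; rewrite gtgt_tau. Qed.

Lemma sum_tau_orth (F : gobj G -> A -> A) g b : (forall y, F y 0 = 0) ->
  \sum_y F y (T g (T (tr y) b)) = F (gsrc g) (T g (T (tr (gsrc g)) b)).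
Proof.
move=> F0; rewrite (bigD1 (gsrc g)) //= big1 ?addr0 // => y /eqP gy.
by rewrite twist_tau_orth ?F0 // => yg; apply: gy.
Qed.

(** Multiplying the coordinates by 1_x changes none of the Galois sums over loops at [x], since T_l
    takes values in B_x and only depends on the component in B_x. *)
Lemma galois_restr : pa_galois th -> pa_galois thx.
Proof.
move/galois_skew_one => [r [a [b [_ _ abE]]]].
have xx := one_idem tw (gid x).
apply: (skew_one_galois twisted_restr (a := fun i => a i ** one (gid x))
    (b := fun i => b i ** one (gid x))) => [i|i|l].
- by apply/(tw_dom tw); rewrite -rngmulA xx.
- by apply/(tw_dom tw); rewrite -rngmulA xx.
transitivity (\sum_i a i ** T (val l) (b i)).
  apply: eq_bigr => i _; rewrite pa_twistEx twist_one_at ?gsrc_loop //.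
  by rewrite -rngmulA -(tw_oneC tw) twist_t_at ?gtgt_loop.
rewrite abE !ffunE gsrc_loop; congr (if _ then _ else _).
Qed.

Lemma twist_tau_one y : T (tr y) (one (gid x)) = one (gid y).
Proof.
by rewrite twist_one ?gsrc_tau ?gtgt_id // gcomp1r_at ?gsrc_tau // one_idem // tau_one.
Qed.

(** The new coordinates are the translates of the old ones along all tau_y, indexed by pairs of an
    old index and an object. *)
Lemma galois_extend : pa_galois thx -> pa_galois th.
Proof.
move/galois_skew_one => [r [a [b [_ _ abE]]]].
apply: (skew_one_galois (I := ('I_r * gobj G)%type) tw (a := fun i => T (tr i.2) (a i.1))
  (b := fun i => T (tr i.2) (b i.1))) => [i|i|g]; try exact: ring_twist.
rewrite -(pair_bigA _ (fun i y => T (tr y) (a i) ** T g (T (tr y) (b i)))) /=.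
under eq_bigr => i _.
  (* Only y = s(g) survives, and T_g T_{tau_{s(g)}} becomes T_{tau_{t(g)}} T_{g_x}. *)
  rewrite (sum_tau_orth (F := fun y c => T (tr y) (a i) ** c)); last by move=> y; rewrite rngmul0r.
  rewrite twist_tau_loop.
  over.
(* The two factors lie in B_{s(g)} and B_{t(g)}, so they are orthogonal unless s(g) = t(g). In that
   case T_{tau_{s(g)}} comes out of the sum and the Galois equation for g_x applies. *)
have [gg|/eqP gg] := eqVneq (gsrc g) (gtgt g); last first.
  rewrite big1 => [|i _]; last by rewrite twist_mul_orth // !gtgt_tau.
  rewrite ffunE; case: eqP => // gE; case: gg.
  by rewrite [in RHS]gE gtgt_id.
rewrite -gg; under eq_bigr do rewrite -(tw_M tw).
rewrite -twist_sum // abE !ffunE -[gid _]/(loop_id x) loop_conj_id //.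
case: eqP => [gE|_]; last exact: twist0.
have /eqP -> : loop_conj tr g == loop_id x by rewrite loop_conj_id //; apply/eqP.
by rewrite pa_oneEx twist_tau_one [in RHS]gE.
Qed.

Lemma sum_loop (F : G -> A) :
  \sum_(l : isotropy x) F (val l) = \sum_(g | is_loop x g) F g.
Proof.
rewrite [RHS](reindex_onto val (insubd (loop_id x))) /=.
  by apply: eq_bigl => l; rewrite (valP l) valKd eqxx.
by move=> g gx; rewrite insubdK.
Qed.

(** Arrows whose source is not [x] kill [b], and values of arrows whose target is not [x] are killed
    by 1_x; the loops remain. *)
Lemma trace_mul_one b : b ** one (gid x) = b -> t b ** one (gid x) = tx b.
Proof.
move=> bE; rewrite [RHS](sum_loop (fun g => T g b)) /pa_trace rngmul_suml.
rewrite (bigID (is_loop x)) /= [X in _ + X]big1 ?addr0 => [|g].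
  by apply: eq_bigr => g /andP[_ /eqP gx]; apply: twist_t_at.
rewrite negb_and => /orP[/eqP gx|/eqP gx].
  rewrite twist_orth ?rngmul0l // -bE -rngmulA one_orth ?rngmul0r //.
  by rewrite gtgt_id gtgt_inv => xg; apply: gx.
by rewrite -(tw_mul1 tw) -rngmulA one_orth ?rngmul0r // gtgt_id.
Qed.

(** Every trace is the trace of an element of B_x: moving each component c 1_y back to B_x along
    tau_y^-1 keeps its trace, by [trace_twist]. *)
Lemma sum_tau_trace c : exists2 d, d ** one (gid x) = d & t d = t c.
Proof.
exists (\sum_y T (ginv (tr y)) c).
  rewrite rngmul_suml; apply: eq_bigr => y _; apply: twist_t_at.
  by rewrite gtgt_inv gsrc_tau.
rewrite trace_sum // -[in RHS](_ : \sum_y t (c ** one (gid y)) = t c); last first.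
  rewrite -trace_sum // -rngmul_sumr -/u.
  by apply: eq_bigr => g _; apply: twist_mul_unitr.
by apply: eq_bigr => y _; rewrite trace_twist // ginvK tau_one.
Qed.

Lemma invariant_restr a : pa_invariants th a -> pa_invariants thx (a ** one (gid x)).
Proof.
case=> _ aT; split=> [|l]; first by apply/(tw_dom tw); rewrite -rngmulA one_idem.
rewrite pa_twistEx twist_one_at ?gsrc_loop // aT -rngmulA pa_oneEx.
by have := one_t tw (val l); rewrite gtgt_loop => ->.
Qed.

(** The extension is sum_y theta_{tau_y}(b); its component at [x] is [b] because tau_x is the
    identity. *)
Lemma invariant_extend b : pa_invariants thx b ->
  exists2 a, pa_invariants th a & a ** one (gid x) = b.
Proof.
case=> /(tw_dom tw) bE bT; exists (\sum_y T (tr y) b); last first.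
  rewrite rngmul_suml (bigD1 x) //= big1 => [|y /eqP yx].
    by rewrite addr0 tau_base (tw_id tw) -rngmulA one_idem.
  by rewrite -(tw_mul1 tw) -rngmulA one_orth ?rngmul0r // gtgt_id gtgt_tau.
split=> [|g].
  by apply: (subgroup_set_sum (subgroup_ring tw)) => y _; apply: ring_twist.
rewrite twist_sum // (sum_tau_orth (F := fun=> id)) // twist_tau_loop bT (tw_M tw).
rewrite rngmul_suml (bigD1 (gtgt g)) //= big1 ?addr0 => [|y /eqP yg]; last first.
  by rewrite -(tw_mul1 tw) -rngmulA one_orth ?rngmul0r // gtgt_tau.
(* Obtained by applying [twist_tau_loop] to the identity of the ring. *)
have -> : T (tr (gtgt g)) (one (val (loop_conj tr g))) = one g; last by [].
rewrite -[one (val _)](twist_unit tw) -[T (val _) _](pa_twistEx).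
by rewrite -twist_tau_loop twist_unit // tau_one twist_one ?gtgt_id // gcomp1r one_idem.
Qed.

(** An invariant is determined by its component at [x], since invariance under tau_y gives a 1_y =
    theta_{tau_y}(a 1_x). *)
Lemma invariant_eq a b : pa_invariants th a -> pa_invariants th b ->
  a ** one (gid x) = b ** one (gid x) -> a = b.
Proof.
move=> aI bI ab; suff inv c : pa_invariants th c -> c = \sum_y T (tr y) (c ** one (gid x)).
  by rewrite (inv a) // (inv b) // ab.
move=> [/(tw_ring tw) cE cT]; rewrite -{1}cE rngmul_sumr; apply: eq_bigr => y _.
by rewrite twist_one_at ?gsrc_tau // cT tau_one.
Qed.

Lemma trace_onto_restr : pa_trace_onto th -> pa_trace_onto thx.
Proof.
move=> onto b /invariant_extend[a aI <-].
have [c _ <-] := onto a aI; have [d dE <-] := sum_tau_trace c.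
by exists d; [apply/(tw_dom tw) | rewrite trace_mul_one].
Qed.

Lemma trace_onto_extend : pa_trace_onto thx -> pa_trace_onto th.
Proof.
move=> onto a aI; have [b /(tw_dom tw) bE btx] := onto _ (invariant_restr aI).
exists b; first by apply/(tw_ring tw); rewrite -bE -rngmulA one_mul_unit.
by apply: invariant_eq => //; [apply: trace_invariant | rewrite trace_mul_one].
Qed.

End IsotropyRestriction.

(** * Unital ideals and their central idempotents *)

Section UnitalIdeals.

Variable A : rngType.
Implicit Types (I J K : set A) (a b c d e : A).

Lemma identity_unique I d e : is_identity I d -> is_identity I e -> d = e.
Proof. by move=> [Id dI] [Ie eI]; rewrite -[LHS](eI d Id).2 (dI e Ie).1. Qed.

Lemma identity_of_is I : unital_set I -> is_identity I (identity_of I).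
Proof. exact: xgetPex. Qed.

Lemma identity_ofE I e : is_identity I e -> identity_of I = e.
Proof. by move=> eI; apply: identity_unique (eI); apply: identity_of_is; exists e. Qed.

(** Being an ideal is not transitive in general; here ab = (ae)b with ae in [J], and symmetrically
    on the other side. *)
Lemma ideal_of_trans K J I e :
  ideal_of K J -> ideal_of J I -> is_identity I e -> ideal_of K I.
Proof.
move=> [JK _ idJ] [IJ subI idI] [Ie eI]; split=> // [a /IJ/JK//|a b Ka Ib].
have [Jae Jea] := idJ a e Ka (IJ e Ie).
rewrite -{1}(eI b Ib).1 -{2}(eI b Ib).2 rngmulA -[_ ** _ ** a]rngmulA.
by split; [case: (idI _ b Jae Ib) | case: (idI _ b Jea Ib)].
Qed.

Lemma unital_idealP I e : ideal_of setT I -> is_identity I e ->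
  (forall a, a ** e = e ** a) /\ (forall a, I a <-> a ** e = a).
Proof.
move=> [_ _ idI] [Ie eI]; split=> a.
  have [Iae Iea] := idI a e Logic.I Ie.
  by rewrite -[LHS](eI _ Iae).1 rngmulA (eI _ Iea).2.
split=> [Ia|<-]; first by case: (eI a Ia).
by case: (idI a e Logic.I Ie).
Qed.

End UnitalIdeals.

(** * From the axioms of a unital partial action to the calculus *)

Section TwistedPaction.

Variables (G : groupoid) (A : rngType) (al : paction G A).
Implicit Types (g h : G) (a b c : A).

Local Notation D := (pa_dom al).
Local Notation f := (pa_fun al).
Local Notation one := (pa_one al).
Local Notation T := (pa_twist al).

Hypothesis al_paction : is_paction al.
Hypothesis al_unital : unital_paction al.
Hypothesis al_ideal : ideal_of setT (pa_ring al).
Hypothesis al_orth : forall y z, y <> z -> one (gid y) ** one (gid z) = 0.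
Hypothesis al_ring : forall a, pa_ring al a <-> a ** pa_unit al = a.

Let oneP g : is_identity (D g) (one g).
Proof. exact: identity_of_is. Qed.

Let idealD g : ideal_of setT (D g).
Proof.
have [/(_ g)[idJ idD _] _ _ _] := al_paction.
exact: ideal_of_trans (ideal_of_trans al_ideal idJ (oneP _)) idD (oneP g).
Qed.

Let oneC g a : a ** one g = one g ** a.
Proof. exact: (unital_idealP (idealD g) (oneP g)).1. Qed.

Let domP g a : D g a <-> a ** one g = a.
Proof. exact: (unital_idealP (idealD g) (oneP g)).2. Qed.

Let dom_mull g a b : D g b -> D g (a ** b).
Proof. by move/domP => bE; apply/domP; rewrite -rngmulA bE. Qed.

Let dom_mulr g a b : D g a -> D g (a ** b).
Proof. by move/domP => aE; apply/domP; rewrite -rngmulA oneC rngmulA aE. Qed.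

Let dom_one g : D g (one g).
Proof. by case: (oneP g). Qed.

Let iso g : rng_iso (D (ginv g)) (D g) (f g).
Proof. by have [/(_ g)[]] := al_paction. Qed.

Let f_dom g a : D (ginv g) a -> D g (f g a).
Proof. by have [[fD _ _] _ _] := iso g; apply: fD. Qed.

Let f_surj g b : D g b -> exists2 a, D (ginv g) a & f g a = b.
Proof. by have [[_ _ fs] _ _] := iso g; apply: fs. Qed.

Let f_mul g a b : D (ginv g) a -> D (ginv g) b -> f g (a ** b) = f g a ** f g b.
Proof. by have [_ _ fM] := iso g; apply: fM. Qed.

Let T_dom g a : D g (T g a).
Proof. by apply: f_dom; apply: dom_mull. Qed.

Let T_mul g a b : T g (a ** b) = T g a ** T g b.
Proof.
rewrite -f_mul; try exact: dom_mull; congr f.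
by rewrite rngmulA -[a ** _ ** b]rngmulA -oneC -!rngmulA ((oneP _).2 _ (dom_one _)).1.
Qed.

Let T_1V g : T g (one (ginv g)) = one g.
Proof.
rewrite /pa_twist ((oneP _).2 _ (dom_one _)).1.
apply: identity_unique (oneP g); split=> [|b /f_surj[a Da <-]]; first exact: f_dom.
by rewrite -!f_mul ?((oneP _).2 _ Da).1 ?((oneP _).2 _ Da).2.
Qed.

Let T_id y a : T (gid y) a = a ** one (gid y).
Proof.
have [_ fid _ _] := al_paction.
by rewrite /pa_twist ginv_id fid //; apply: dom_mull.
Qed.

Let one_id g : one g ** one (gid (gtgt g)) = one g.
Proof. by have [/(_ g)[_ [DD _ _] _] _ _ _] := al_paction; apply/domP/DD. Qed.

(** Let c be the preimage of 1_h 1_{g^-1} under alpha_h. Both c and ac lie in the domain of the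
    composite, and alpha_{gh}(ac) = T_{gh}(a) alpha_{gh}(c) is the claim. *)
Let T_comp_one g h a : gsrc g = gtgt h ->
  T g (T h a) = T (gcomp g h) a ** T g (one h).
Proof.
move=> gh; have [_ _ domgh fgh] := al_paction.
have [c Dc fc] : exists2 c, D (ginv h) c & f h c = one h ** one (ginv g).
  by apply: f_surj; apply: dom_mulr.
have cdom : pa_comp_dom al g h c.
  by split=> //; rewrite fc; split; [apply: dom_mull | apply: dom_mulr].
have Dghc := domgh _ _ gh _ cdom.
have hacE : f h (a ** c) = T h a ** one (ginv g).
  rewrite -[c](((oneP _).2 _ Dc).1) rngmulA f_mul //; last exact: dom_mull.
  by rewrite fc rngmulA ((oneP _).2 _ (T_dom h a)).2.
have acdom : pa_comp_dom al g h (a ** c).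
  split; first exact: dom_mull.
  by rewrite /= hacE; split; [apply: dom_mull | apply: dom_mulr].
rewrite [LHS]/pa_twist -hacE fgh // [T g (one h)]/pa_twist -fc fgh // -f_mul //.
  by rewrite -rngmulA ((oneP _).2 _ Dghc).1.
exact: dom_mull.
Qed.

(** By [T_comp_one], T_g(1_h) lies in the ideal of gh (this is [le]). Applying the same fact to g^-1
    and gh, and then T_g, gives the reverse inequality of idempotents. *)
Let T_one g h : gsrc g = gtgt h -> T g (one h) = one (gcomp g h) ** one g.
Proof.
have T_VK b : T g (T (ginv g) b) = b ** one g.
  by rewrite T_comp_one ?gtgt_inv // T_1V gcompVr T_id -rngmulA -oneC one_id.
have le g' h' : gsrc g' = gtgt h' ->
    one (gcomp g' h') ** T g' (one h') = T g' (one h').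
  move=> gh; rewrite -(T_1V h') T_comp_one // rngmulA.
  by rewrite ((oneP _).2 _ (T_dom _ _)).1.
move=> gh; have gh' : gsrc (ginv g) = gtgt (gcomp g h) by rewrite gsrc_inv gtgt_comp.
rewrite -T_VK -(le _ _ gh') gcompVK // T_mul T_VK rngmulA (oneC (gcomp g h)) le //.
by rewrite ((oneP _).2 _ (T_dom _ _)).2.
Qed.

Lemma twisted_paction : twisted al.
Proof.
split=> //.
- move=> g a b; have [_ fD _] := iso g.
  by rewrite /pa_twist rngmulDl fD //; apply: dom_mull.
- move=> g h a gh; rewrite T_comp_one // T_one // rngmulA.
  by rewrite ((oneP _).2 _ (T_dom _ _)).2.
- by move=> g a; rewrite ((oneP _).2 _ (T_dom _ _)).2.
Qed.

End TwistedPaction.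

(** * The extension of gamma satisfies the calculus *)

Section TwistedExt.

Variables (G : groupoid) (x : gobj G) (tr : gtransversal x).
Variables (A : rngType) (ga : ddata x A).
Hypothesis ga_obj : is_dobject tr ga.
Hypothesis ga_full : forall y, dItauV ga y = dI ga x /\ dItau ga y = dI ga y.
Hypothesis gax_unital : unital_paction (diso ga).
Hypothesis A_sum : direct_sum_of (dI ga).

Implicit Types (g h : G) (y z : gobj G) (l : isotropy x) (a b c d : A).

(** Here [s y] is gamma_{tau_y}, an isomorphism from I_x onto I_y with inverse [r y]; [v] is the
    identity of I_x, and [w y] its image, the identity of I_y. *)
Local Notation J := (dI ga x).
Local Notation al := (diso ga).
Local Notation th := (Ext tr ga).
Local Notation s := (dtau ga).
Local Notation r := (fun y => pb_fun (pb_inv (dtau_pbij ga y))).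
Local Notation gx := (loop_conj tr).
Local Notation K := (pa_twist al).
Local Notation v := (pa_one al (gid (tt : gobj (isotropy x)))).
Local Notation w := (fun y => s y v).

Lemma loop_conj_unique g l :
  gcomp (tr (gtgt g)) (val l) = gcomp g (tr (gsrc g)) -> gx g = l.
Proof.
by move=> gE; apply/val_inj; rewrite /= -gE gcompVK // gsrc_tau gtgt_loop.
Qed.

(** The inner factors tau_{t(h)} and its inverse cancel, so conjugation by the transversal is a
    functor from the groupoid to its isotropy group at [x]. *)
Lemma loop_conj_comp g h : gsrc g = gtgt h ->
  gx (gcomp g h) = gcomp (gx g) (gx h).
Proof.
move=> gh; apply: loop_conj_unique; rewrite gtgt_comp // gsrc_comp //.
rewrite /= gcompA ?gsrc_tau ?(gtgt_loop (gx g)) ?(gsrc_loop (gx g)) ?(gtgt_loop (gx h)) //.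
rewrite tau_loop_conj gh -gcompA ?gtgt_tau ?gsrc_tau ?(gtgt_loop (gx h)) //.
by rewrite tau_loop_conj gcompA ?gtgt_tau.
Qed.

Lemma loop_conj_gid y : gx (gid y) = loop_id x.
Proof. by apply/eqP; rewrite loop_conj_id ?gsrc_id ?gtgt_id. Qed.

Lemma loop_conj_inv g : gx (ginv g) = ginv (gx g).
Proof.
apply: ginv_unique => //; rewrite -loop_conj_comp ?gsrc_inv ?gtgt_inv //.
by rewrite gcompVr loop_conj_gid.
Qed.

Let idealI y : ideal_of setT (dI ga y).
Proof. by case: ga_obj. Qed.

Let isoI y : rng_iso J (dI ga y) (s y).
Proof.
have [_ /(_ y)[_ _] + _ _ _] := ga_obj.
by have [-> ->] := ga_full y.
Qed.

Let al_paction : is_paction al.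
Proof. by have [_ _ _ [] ] := ga_obj. Qed.

Let al_ring : pa_ring al = J.
Proof. by have [_ _ _ [] ] := ga_obj. Qed.

Let al_id : pa_dom al (gid (tt : gobj (isotropy x))) = J.
Proof. by have [_ _ _ [] ] := ga_obj. Qed.

Let v_one : is_identity J v.
Proof. by rewrite /pa_one al_id; apply: identity_of_is; rewrite -al_id; apply: gax_unital. Qed.

Let J_E a : J a <-> a ** v = a.
Proof. exact: (unital_idealP (idealI x) v_one).2. Qed.

Let J_v : J v. Proof. by case: v_one. Qed.

Let tw_al : twisted al.
Proof.
apply: twisted_paction => //; first by rewrite al_ring.
  by move=> [] [].
move=> a; rewrite al_ring J_E /pa_unit.
by rewrite (big_pred1 tt).
Qed.

Let K_J l a : J (K l a).
Proof. by apply/J_E; apply: (twist_t tw_al l). Qed.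

Let dom_J l a : pa_dom al l a -> J a.
Proof.
by move/(tw_dom tw_al) => <-; apply/J_E; rewrite -rngmulA; congr (_ ** _); apply: (tw_1t tw_al l).
Qed.

Let one_J l : J (pa_one al l).
Proof. by apply/J_E; apply: (tw_1t tw_al l). Qed.

Let J_mul a b : J a -> J b -> J (a ** b).
Proof. by move=> _ /J_E bE; apply/J_E; rewrite -rngmulA bE. Qed.

Let s_I y a : J a -> dI ga y (s y a).
Proof. by have [[sI _ _] _ _] := isoI y; apply: sI. Qed.

Let s_inj y a b : J a -> J b -> s y a = s y b -> a = b.
Proof. by have [[_ + _] _ _] := isoI y => + Ja Jb; apply; apply/mem_set. Qed.

Let sD y a b : J a -> J b -> s y (a + b) = s y a + s y b.
Proof. by have [_ + _] := isoI y; apply. Qed.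

Let sM y a b : J a -> J b -> s y (a ** b) = s y a ** s y b.
Proof. by have [_ _ +] := isoI y; apply. Qed.

Let rK y b : dI ga y b -> J (r y b) /\ s y (r y b) = b.
Proof.
move=> Ib; have [[_ _ ss] _ _] := isoI y; have [a Ja sa] := ss b Ib.
have [VE _] := ga_full y; rewrite /= VE.
by apply: (@xgetPex _ _ [set a | J a /\ s y a = b]); exists a.
Qed.

Let sK y a : J a -> r y (s y a) = a.
Proof. by move=> Ja; have [Jr sr] := rK (s_I y Ja); apply: (@s_inj y). Qed.

Let w_one y : is_identity (dI ga y) (w y).
Proof.
split=> [|b Ib]; first exact: s_I.
have [Ja <-] := rK Ib; rewrite -!sM //.
by case: v_one => _ /(_ _ Ja)[-> ->].
Qed.

Let wC y a : a ** w y = w y ** a.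
Proof. exact: (unital_idealP (idealI y) (w_one y)).1. Qed.

Let I_E y a : dI ga y a <-> a ** w y = a.
Proof. exact: (unital_idealP (idealI y) (w_one y)).2. Qed.

Let I_w y a : dI ga y (a ** w y).
Proof. by apply/I_E; rewrite -rngmulA; congr (_ ** _); apply/I_E; case: (w_one y). Qed.

(** A common element would have two decompositions, one concentrated at [y] and one at [z];
    uniqueness forces it to vanish. The orthogonality of the 1_y follows. *)
Let I_cap y z a : y <> z -> dI ga y a -> dI ga z a -> a = 0.
Proof.
move=> yz Iy Iz; have [f [_ f_uniq]] := A_sum a.
have I0 y' : dI ga y' 0 by case: (idealI y') => _ [].
pose single y' : {ffun gobj G -> A} := [ffun z' => if z' == y' then a else 0].
have singleE y' : dI ga y' a -> f = single y'.
  move=> Iy'; apply: f_uniq; split=> [z'|]; first by rewrite ffunE; case: eqP => // ->.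
  by rewrite (bigD1 y') //= ffunE eqxx big1 ?addr0 // => z' /negPf z'y; rewrite ffunE z'y.
have := congr1 (fun f : {ffun gobj G -> A} => f y) (singleE z Iz).
rewrite (singleE y Iy) !ffunE eqxx; case: eqP => // yz'; by case: yz.
Qed.

Let w_orth y z : y <> z -> w y ** w z = 0.
Proof. by move=> yz; apply: (I_cap yz); [rewrite -wC|]; apply: I_w. Qed.

Let w_sum a : a ** \sum_y w y = a.
Proof.
have [f [[If aE] _]] := A_sum a; rewrite aE rngmul_suml; apply: eq_bigr => y _.
rewrite rngmul_sumr (bigD1 y) //= big1 ?addr0 => [|z /eqP zy]; first exact/I_E.
by move/I_E: (If y) => <-; rewrite -rngmulA w_orth ?rngmul0r // => yz; apply: zy.
Qed.

(** B_g = gamma_{tau_{t(g)}}(I_{g_x}) holds uniformly, although [Ext_pbij] treats identities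
    separately: for g = y the loop g_x is the identity of the isotropy group, whose ideal is I_x. *)
Let Ext_domP g b : pa_dom th g b <-> exists2 c, pa_dom al (gx g) c & s (gtgt g) c = b.
Proof.
rewrite /= /pb_range /Ext_pbij; case: eqP => [gE|_] /=.
  have gxE : gx g = gid (tt : gobj (isotropy x)) by rewrite gE loop_conj_gid.
  have stE : gtgt g = gsrc g by rewrite gE gtgt_id gsrc_id.
  rewrite gxE al_id stE; split=> [[b' Ib <-]|[c Jc <-]].
    by have [] := rK Ib; exists (r (gsrc g) b').
  by exists (s (gsrc g) c) => //; apply: s_I.
have [iso_l _ _] : rng_iso (pa_dom al (ginv (gx g))) (pa_dom al (gx g)) (pa_fun al (gx g)).
  by have [/(_ (gx g))[]] := al_paction.
have [VE _] := ga_full (gsrc g); have [VE' _] := ga_full (gtgt g).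
split=> [[a [[_ Da] _] <-]|[c Dc <-]] /=.
  by exists (pa_fun al (gx g) (r (gsrc g) a)) => //; case: iso_l => + _ _; apply.
have [c' Dc' <-] : exists2 c', pa_dom al (ginv (gx g)) c' & pa_fun al (gx g) c' = c.
  by case: iso_l => _ _; apply.
have Jc' := dom_J Dc'.
exists (s (gsrc g) c') => /=; last by rewrite [X in pa_fun _ _ X](sK (gsrc g)).
split; first split.
- by exists c' => //=; rewrite VE.
- by rewrite /= [X in pa_dom _ _ X](sK (gsrc g)).
rewrite /= [X in pa_fun _ _ X](sK (gsrc g)) //.
by rewrite VE'; apply: (@dom_J (gx g)); case: iso_l => + _ _; apply.
Qed.

Let Ext_funE g c : pa_dom al (ginv (gx g)) c ->
  pa_fun th g (s (gsrc g) c) = s (gtgt g) (pa_fun al (gx g) c).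
Proof.
move=> Dc; have Jc := dom_J Dc; rewrite /= /Ext_pbij; case: eqP => [gE|_] /=; last first.
  by rewrite [X in pa_fun _ _ X](sK (gsrc g)).
have gxE : gx g = gid (tt : gobj (isotropy x)) by rewrite gE loop_conj_gid.
have stE : gtgt g = gsrc g by rewrite gE gtgt_id gsrc_id.
by have [_ idE _ _] := al_paction; rewrite stE gxE idE // al_id.
Qed.

Lemma Ext_oneE g : pa_one th g = s (gtgt g) (pa_one al (gx g)).
Proof.
apply: identity_ofE; split=> [|b /Ext_domP[c Dc <-]].
  by apply/Ext_domP; exists (pa_one al (gx g)) => //; apply/(tw_dom tw_al)/one_idem.
have Jc := dom_J Dc; rewrite -!sM //; try exact: one_J.
by move/(tw_dom tw_al): Dc => cE; rewrite -(tw_oneC tw_al) !cE.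
Qed.

(** The inverse of gamma_{tau_y} made total by first projecting [A] onto I_y; it stays additive and
    multiplicative. *)
Let R y a := r y (a ** w y).

Let R_J y a : J (R y a).
Proof. exact: (rK (I_w y a)).1. Qed.

Let sR y a : s y (R y a) = a ** w y.
Proof. exact: (rK (I_w y a)).2. Qed.

Let Rs y c : J c -> R y (s y c) = c.
Proof.
move=> Jc; rewrite /R; have /I_E -> := s_I y Jc; exact: sK.
Qed.

Let RD y a b : R y (a + b) = R y a + R y b.
Proof.
apply: (@s_inj y) => //; first by apply: (subgroup_setD (X := J)) => //; case: (idealI x).
by rewrite sD // !sR rngmulDl.
Qed.

Let RM y a b : R y (a ** b) = R y a ** R y b.
Proof.
apply: (@s_inj y) => //; first exact: J_mul.
by rewrite sM // !sR -[RHS]rngmulA ((w_one y).2 _ (I_w y b)).1 rngmulA.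
Qed.

Let mul_s y a c : J c -> a ** s y c = s y (R y a ** c).
Proof.
by move=> Jc; rewrite sM // sR -rngmulA ((w_one y).2 _ (s_I y Jc)).1.
Qed.

Let s_mul y a c : J c -> s y c ** a = s y (c ** R y a).
Proof.
by move=> Jc; rewrite sM // sR wC rngmulA ((w_one y).2 _ (s_I y Jc)).2.
Qed.

(** The defining composite of partial bijections, turned into a composite of total maps; it reduces
    the calculus for theta to the one for gamma_(x). *)
Lemma Ext_twistE g a : pa_twist th g a = s (gtgt g) (K (gx g) (R (gsrc g) a)).
Proof.
rewrite /pa_twist Ext_oneE gtgt_inv loop_conj_inv mul_s // Ext_funE //.
by apply/(tw_dom tw_al); rewrite -rngmulA one_idem.
Qed.

Lemma Ext_one_gid y : pa_one th (gid y) = w y.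
Proof. by rewrite Ext_oneE gtgt_id loop_conj_gid. Qed.

(** The loop attached to tau_y is tau_y^-1 tau_y tau_x, the identity at [x]. *)
Lemma Ext_one_tau y : pa_one th (tr y) = pa_one th (gid y).
Proof.
rewrite Ext_one_gid Ext_oneE gtgt_tau; congr (s y (pa_one al _)); apply/val_inj => /=.
by rewrite gtgt_tau gsrc_tau tau_base gcomp1r_at ?gsrc_tau // gcompVl gsrc_tau.
Qed.

Lemma Ext_one_tauV y : pa_one th (ginv (tr y)) = pa_one th (gid x).
Proof.
rewrite Ext_one_gid Ext_oneE gtgt_inv gsrc_tau loop_conj_inv.
congr (s x (pa_one al _)); apply/val_inj => /=.
by rewrite gtgt_tau gsrc_tau tau_base gcomp1r_at ?gsrc_tau // gcompVl gsrc_tau ginv_id.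
Qed.

Lemma twisted_Ext : twisted th.
Proof.
have unitE : pa_unit th = \sum_y w y by apply: eq_bigr => y _; apply: Ext_one_gid.
split.
- by move=> g a; rewrite Ext_oneE mul_s // s_mul // (tw_oneC tw_al).
- by move=> g a b; rewrite !Ext_twistE RD (tw_D tw_al) sD.
- by move=> g a b; rewrite !Ext_twistE RM (tw_M tw_al) sM.
- move=> g h a gh; rewrite !Ext_twistE gh Rs // (tw_comp tw_al) // -loop_conj_comp //.
  by rewrite gtgt_comp // gsrc_comp // Ext_oneE -sM.
- by move=> g a; rewrite Ext_twistE Ext_oneE -sM // (tw_mul1 tw_al).
- by move=> g; rewrite Ext_twistE !Ext_oneE gtgt_inv Rs // loop_conj_inv (tw_1V tw_al).
- move=> g; rewrite Ext_one_gid Ext_oneE; exact: ((w_one _).2 _ (s_I _ (one_J _))).2.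
- move=> y a; rewrite Ext_twistE Ext_one_gid gtgt_id gsrc_id loop_conj_gid.
  by rewrite [K _ _](tw_id tw_al tt) (_ : _ ** v = R y a) ?sR //; apply/J_E.
- by move=> y z yz; rewrite !Ext_one_gid w_orth.
- by move=> a; rewrite unitE w_sum.
- move=> g a; rewrite Ext_domP Ext_oneE; split=> [[c Dc <-]|aE].
    rewrite -sM //; last exact: dom_J Dc.
    by move/(tw_dom tw_al): Dc => ->.
  exists (R (gtgt g) a ** pa_one al (gx g)); last by rewrite -mul_s.
  by apply/(tw_dom tw_al); rewrite -rngmulA one_idem.
Qed.

End TwistedExt.

Theorem theorem5p11 (G : groupoid) (x : gobj G) (t : gtransversal x)
    (A : rngType) (ga : ddata x A)
    (G_connected : gconnected G)
    (ga_obj : is_dobject t ga)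
    (ga_full : forall y : gobj G, dItauV ga y = dI ga x /\ dItau ga y = dI ga y)
    (Ix_unital : unital_set (dI ga x))
    (gax_unital : unital_paction (diso ga))
    (A_sum : direct_sum_of (dI ga)) :
  let theta := Ext t ga in
  let theta_x := isotropy_restr x theta in
  [<-> pa_galois theta /\ pa_trace_onto theta;
       strict_morita_context (galois_context theta);
       strict_morita_context (galois_context theta_x);
       pa_galois theta_x /\ pa_trace_onto theta_x].
Proof.
move=> theta theta_x.
have tw : twisted theta by apply: twisted_Ext.
have tau1 y : pa_one theta (t y) = pa_one theta (gid y) by apply: Ext_one_tau.
have tauV1 y : pa_one theta (ginv (t y)) = pa_one theta (gid x) by apply: Ext_one_tauV.
have tw_x : twisted theta_x := twisted_restr x tw.
have restr : pa_galois theta /\ pa_trace_onto theta ->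
    pa_galois theta_x /\ pa_trace_onto theta_x.
  case=> gal onto; split; first exact: galois_restr.
  exact: (trace_onto_restr (tr := t)).
tfae.
- by case; apply: galois_strict.
(* From (ii) to (iii) through (i) and (iv): the coordinates and the trace condition are restricted,
   not the context itself. *)
- by move/strict_galois => /(_ tw)/restr[]; apply: galois_strict.
- exact: strict_galois.
- case=> gal onto; split; first exact: (galois_extend (tr := t)).
  exact: (trace_onto_extend (tr := t)).
Qed.
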